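(* For every behavioral GFG-QPTL sentence $\wp\psi$ with $\psi$ an LTL formula, the three sentences $\wp\psi$, $C_{\exists\forall}(\wp)\psi$ and $C_{\forall\exists}(\wp)\psi$ are equisatisfiable.
   Context: Let $AP$ be a set of atomic propositions and $\mathbb B=\{\top,\bot\}$. A temporal valuation is a function $f:\mathbb N\to\mathbb B$. An assignment is a partial function $\chi:AP\rightharpoonup(\mathbb N\to\mathbb B)$; $\mathrm{Asg}$ is the set of all assignments, $\mathrm{Asg}(P)$ the set of assignments with domain exactly $P\subseteq AP$. For an assignment $\chi$, $p\in AP$ and a temporal valuation $f$, $\chi[p\mapsto f]$ is the assignment that agrees with $\chi$ except that it maps $p$ to $f$. A hyperassignment is a set $\mathcal X$ with $\emptyset\neq\mathcal X\subseteq 2^{\mathrm{Asg}(P)}$ and $\emptyset\notin\mathcal X$, for some $P\subseteq AP$; this $P$ is denoted $\mathrm{ap}(\mathcal X)$. $\mathrm{HAsg}$ is the set of all hyperassignments, $\mathrm{HAsg}(P)$ those with $\mathrm{ap}(\mathcal X)=P$, and $\mathrm{HAsg}_\supseteq(P)$ those with $\mathrm{ap}(\mathcal X)\supseteq P$. A choice function for $\mathcal X$ is a map $c:\mathcal X\to\mathrm{Asg}$ with $c(X)\in X$ for all $X\in\mathcal X$. The dual of $\mathcal X$ is $\overline{\mathcal X}=\{\mathrm{img}(c): c\text{ a choice function for }\mathcal X\}$. $\mathrm{par}(\mathcal X)$ is the set of pairs $(\mathcal X_1,\mathcal X_2)$ of (possibly empty) subsets of $\mathcal X$ with $\mathcal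 X_1\cap\mathcal X_2=\emptyset$ and $\mathcal X_1\cup\mathcal X_2=\mathcal X$. A functor over $P\subseteq AP$ is a function $F:\mathrm{Asg}(P)\to(\mathbb N\to\mathbb B)$; $\mathrm{Fnc}(P)$ is the set of all of them. $\mathrm{ext}(\chi,F,p)=\chi[p\mapsto F(\chi)]$ and $\mathrm{ext}(X,F,p)=\{\mathrm{ext}(\chi,F,p):\chi\in X\}$. For $\chi_1,\chi_2\in\mathrm{Asg}(P)$, $p\in P$, $k\in\mathbb N$: $\chi_1\approx^{>k}_p\chi_2$ iff $\chi_1(q)=\chi_2(q)$ for all $q\in P\setminus\{p\}$ and $\chi_1(p)(t)=\chi_2(p)(t)$ for all $t\le k$; $\chi_1\approx^{\ge k}_p\chi_2$ is defined the same way with $t<k$ in place of $t\le k$. $F\in\mathrm{Fnc}(P)$ is behavioral (resp. strongly behavioral) w.r.t. $p\in P$ if $F(\chi_1)(k)=F(\chi_2)(k)$ for all $k\in\mathbb N$ and all $\chi_1,\chi_2$ with $\chi_1\approx^{>k}_p\chi_2$ (resp. $\chi_1\approx^{\ge k}_p\chi_2$). A quantifier specification is a pair $\sigma=\langle P_B,P_S\rangle$ of subsets of $AP$; $\mathrm{Fnc}_\sigma(P)$ is the set of $F\in\mathrm{Fnc}(P)$ that are behavioral w.r.t. every $p\in P_B\cap P$ and strongly behavioral w.r.t. every $p\in P_S\cap P$. $\mathrm{ext}_\sigma(\mathcal X,p)=\{\mathrm{ext}(X,F,p):X\in\mathcal X,\ F\in\mathrm{Fnc}_\sigma(\mathrm{ap}(\mathcal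 X))\}$. Union of specifications is componentwise. Write $\mathsf B=\langle AP,\emptyset\rangle$. GFG-QPTL formulas are generated by $\varphi::=\psi\mid\neg\varphi\mid\varphi\wedge\varphi\mid\varphi\vee\varphi\mid\exists p{:}\sigma.\varphi\mid\forall p{:}\sigma.\varphi$, where $\psi$ is an LTL formula over $AP$, $p\in AP$ and $\sigma$ a quantifier specification; we also write $\exists^\sigma p.\varphi$, $\forall^\sigma p.\varphi$. QPTL formulas are those in which every specification is $\langle\emptyset,\emptyset\rangle$. $\mathrm{free}(\varphi)$ is the set of free propositions. $\chi\models_{LTL}\psi$ iff the infinite word whose $t$-th letter is the valuation $q\mapsto\chi(q)(t)$ satisfies $\psi$ in the standard LTL sense. Alternation flags are $\exists\forall$ and $\forall\exists$; $\bar\alpha$ is the flag different from $\alpha$. For a GFG-QPTL formula $\varphi$, $\mathcal X\in\mathrm{HAsg}_\supseteq(\mathrm{free}(\varphi))$ and flag $\alpha$, $\mathcal X\models^\alpha\varphi$ is defined inductively: (1) for LTL $\psi$: $\mathcal X\models^{\exists\forall}\psi$ iff there is $X\in\mathcal X$ with $\chi\models_{LTL}\psi$ for all $\chi\in X$; $\mathcal X\models^{\forall\exists}\psi$ iff for every $X\in\mathcal X$ there is $\chi\in X$ with $\chi\models_{LTL}\psi$; (2) $\mathcal X\models^\alpha\neg\phi$ iff not $\mathcal X\models^{\bar\alpha}\phi$; (3) $\mathcal X\models^{\exists\forall}\phi_1\wedge\phi_2$ iff for every $(\mathcal X_1,\mathcal X_2)\in\mathrm{par}(\mathcal X)$, either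 ($\mathcal X_1\ne\emptyset$ and $\mathcal X_1\models^{\exists\forall}\phi_1$) or ($\mathcal X_2\ne\emptyset$ and $\mathcal X_2\models^{\exists\forall}\phi_2$); $\mathcal X\models^{\forall\exists}\phi_1\wedge\phi_2$ iff $\overline{\mathcal X}\models^{\exists\forall}\phi_1\wedge\phi_2$; (4) $\mathcal X\models^{\forall\exists}\phi_1\vee\phi_2$ iff there is $(\mathcal X_1,\mathcal X_2)\in\mathrm{par}(\mathcal X)$ such that ($\mathcal X_1\neq\emptyset$ implies $\mathcal X_1\models^{\forall\exists}\phi_1$) and ($\mathcal X_2\neq\emptyset$ implies $\mathcal X_2\models^{\forall\exists}\phi_2$); $\mathcal X\models^{\exists\forall}\phi_1\vee\phi_2$ iff $\overline{\mathcal X}\models^{\forall\exists}\phi_1\vee\phi_2$; (5) $\mathcal X\models^{\exists\forall}\exists p{:}\sigma.\phi$ iff $\mathrm{ext}_\sigma(\mathcal X,p)\models^{\exists\forall}\phi$; $\mathcal X\models^{\forall\exists}\exists p{:}\sigma.\phi$ iff $\overline{\mathcal X}\models^{\exists\forall}\exists p{:}\sigma.\phi$; (6) $\mathcal X\models^{\forall\exists}\forall p{:}\sigma.\phi$ iff $\mathrm{ext}_\sigma(\mathcal X,p)\models^{\forall\exists}\phi$; $\mathcal X\models^{\exists\forall}\forall p{:}\sigma.\phi$ iff $\overline{\mathcal X}\models^{\forall\exists}\forall p{:}\sigma.\phi$. A GFG-QPTL formula $\varphi$ is $\alpha$-satisfiable if $\mathcal X\models^\alpha\varphi$ for some $\mathcal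 X\in\mathrm{HAsg}(\mathrm{free}(\varphi))$, and satisfiable if it is both $\exists\forall$- and $\forall\exists$-satisfiable. A sentence has no free propositions (so the only candidate is $\mathcal X=\{\{\emptyset\}\}$, where $\emptyset$ is the empty assignment). A quantifier prefix is a finite sequence $\wp=Q_1^{\sigma_1}p_1\cdots Q_n^{\sigma_n}p_n$; $\wp\phi$ denotes $Q_1^{\sigma_1}p_1.\cdots Q_n^{\sigma_n}p_n.\phi$. It is behavioral if every $\sigma_i=\mathsf B$; a behavioral GFG-QPTL formula is one of the form $\wp\psi$ with $\wp$ behavioral, propositions $p_i$ pairwise distinct, and $\psi$ LTL. For a vector $\vec p$, $Q^\sigma\vec p$ quantifies its entries in order with specification $\sigma$. Canonical forms. Every behavioral prefix $\wp$ can be uniquely written as $\exists^{\mathsf B}\vec q_0.\forall^{\mathsf B}\vec p_1.\exists^{\mathsf B}\vec q_1\cdots\forall^{\mathsf B}\vec p_k.\exists^{\mathsf B}\vec q_k.\forall^{\mathsf B}\vec p_{k+1}$ with $k\in\mathbb N$, $\vec q_0,\vec p_{k+1}$ possibly empty and $\vec p_i,\vec q_i$ nonempty for $1\le i\le k$; then $C_{\exists\forall}(\wp)=\exists^{\mathsf B}\vec q_0\cdots\exists^{\mathsf B}\vec q_k.\forall^{\tau_1}\vec p_1\cdots\forall^{\tau_{k+1}}\vec p_{k+1}$ where $\tau_i=\mathsf B\cup\langle\emptyset,\vec q_i\cup\cdots\cup\vec q_k\rangle$ (for $i=k+1$, $\tau_{k+1}=\mathsf B$). Dually, writing $\wp$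 uniquely as $\forall^{\mathsf B}\vec p_0.\exists^{\mathsf B}\vec q_1.\forall^{\mathsf B}\vec p_1\cdots\exists^{\mathsf B}\vec q_k.\forall^{\mathsf B}\vec p_k.\exists^{\mathsf B}\vec q_{k+1}$ (with $\vec p_0,\vec q_{k+1}$ possibly empty, the others nonempty), $C_{\forall\exists}(\wp)=\forall^{\mathsf B}\vec p_0\cdots\forall^{\mathsf B}\vec p_k.\exists^{\tau_1}\vec q_1\cdots\exists^{\tau_{k+1}}\vec q_{k+1}$ with $\tau_i=\mathsf B\cup\langle\emptyset,\vec p_i\cup\cdots\cup\vec p_k\rangle$. *)

(* Defs.v *)
From Stdlib Require Import List Arith Classical ClassicalEpsilon.
Import ListNotations.
Set Implicit Arguments.

Section GFG.
Variable AP : Type.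

Definition tval := nat -> bool.
Definition Asg := AP -> option tval.

Definition Asg_on (P : AP -> Prop) (chi : Asg) : Prop :=
  forall q, P q <-> chi q <> None.

Definition upd (chi : Asg) (p : AP) (f : tval) : Asg :=
  fun q => if excluded_middle_informative (q = p) then Some f else chi q.

Definition ASet := Asg -> Prop.
Definition HSet := ASet -> Prop.

Definition isHAsg (X : HSet) (P : AP -> Prop) : Prop :=
  (exists Y, X Y) /\
  (forall Y, X Y -> exists chi, Y chi) /\
  (forall Y, X Y -> forall chi, Y chi -> Asg_on P chi).

(** ap(X): the common domain of the assignments in X *)
Definition ap (X : HSet) : AP -> Prop :=
  fun q => exists Y, X Y /\ exists chi, Y chi /\ chi q <> None.

Definition dual (X : HSet) : HSet :=
  fun Y => exists c : ASet -> Asg,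
    (forall Z, X Z -> Z (c Z)) /\
    Y = (fun chi => exists Z, X Z /\ chi = c Z).

Definition par (X X1 X2 : HSet) : Prop :=
  (forall Y, X1 Y -> X Y) /\ (forall Y, X2 Y -> X Y) /\
  (forall Y, X Y -> X1 Y \/ X2 Y) /\ (forall Y, ~ (X1 Y /\ X2 Y)).

Definition nonempty (X : HSet) : Prop := exists Y, X Y.

(** functors over P: total functions; only their values on Asg(P) matter *)
Definition Fnc := Asg -> tval.

Definition agree (P : AP -> Prop) (p : AP) (k : nat) (strong : bool)
  (chi1 chi2 : Asg) : Prop :=
  (forall q, P q -> q <> p -> chi1 q = chi2 q) /\
  (forall f1 f2, chi1 p = Some f1 -> chi2 p = Some f2 ->
     forall t, (if strong then t < k else t <= k) -> f1 t = f2 t).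

Definition behavioral_wrt (P : AP -> Prop) (strong : bool) (F : Fnc) (p : AP) :=
  forall k chi1 chi2, Asg_on P chi1 -> Asg_on P chi2 ->
    agree P p k strong chi1 chi2 -> F chi1 k = F chi2 k.

Definition spec := ((AP -> Prop) * (AP -> Prop))%type.
Definition spec_union (s1 s2 : spec) : spec :=
  (fun q => fst s1 q \/ fst s2 q, fun q => snd s1 q \/ snd s2 q).
Definition specB : spec := (fun _ => True, fun _ => False).
Definition spec_empty_S (S : AP -> Prop) : spec := (fun _ => False, S).

Definition Fnc_sigma (s : spec) (P : AP -> Prop) (F : Fnc) : Prop :=
  (forall p, fst s p -> P p -> behavioral_wrt P false F p) /\
  (forall p, snd s p -> P p -> behavioral_wrt P true F p).

Definition ext_set (Y : ASet) (F : Fnc) (p : AP) : ASet :=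
  fun chi => exists chi0, Y chi0 /\ chi = upd chi0 p (F chi0).

Definition ext_sigma (s : spec) (X : HSet) (p : AP) : HSet :=
  fun Y => exists Y0 F, X Y0 /\ Fnc_sigma s (ap X) F /\ Y = ext_set Y0 F p.

Inductive ltl : Type :=
| LAtom : AP -> ltl
| LTrue : ltl
| LNot : ltl -> ltl
| LAnd : ltl -> ltl -> ltl
| LOr : ltl -> ltl -> ltl
| LNext : ltl -> ltl
| LUntil : ltl -> ltl -> ltl.

Fixpoint ltl_sat (w : nat -> AP -> bool) (psi : ltl) (i : nat) : Prop :=
  match psi with
  | LAtom p => w i p = true
  | LTrue => True
  | LNot a => ~ ltl_sat w a i
  | LAnd a b => ltl_sat w a i /\ ltl_sat w b i
  | LOr a b => ltl_sat w a i \/ ltl_sat w b i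
  | LNext a => ltl_sat w a (S i)
  | LUntil a b => exists j, i <= j /\ ltl_sat w b j /\
                    forall k, i <= k -> k < j -> ltl_sat w a k
  end.

(** the word of chi: t-th letter is q |-> chi(q)(t) (undefined q read as false;
    irrelevant since free(psi) is contained in the domain) *)
Definition word_of (chi : Asg) : nat -> AP -> bool :=
  fun t q => match chi q with Some f => f t | None => false end.

Definition ltl_models (chi : Asg) (psi : ltl) : Prop := ltl_sat (word_of chi) psi 0.

Fixpoint ltl_free (psi : ltl) (q : AP) : Prop :=
  match psi with
  | LAtom p => q = p
  | LTrue => False
  | LNot a | LNext a => ltl_free a q
  | LAnd a b | LOr a b | LUntil a b => ltl_free a q \/ ltl_free b q
  end.

Inductive form : Type :=
| FLTL : ltl -> form
| FNot : form -> form
| FAnd : form -> form -> form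
| FOr : form -> form -> form
| FEx : AP -> spec -> form -> form
| FAll : AP -> spec -> form -> form.

Fixpoint free (phi : form) (q : AP) : Prop :=
  match phi with
  | FLTL psi => ltl_free psi q
  | FNot a => free a q
  | FAnd a b | FOr a b => free a q \/ free b q
  | FEx p _ a | FAll p _ a => free a q /\ q <> p
  end.

Inductive flag := EA | AE.
Definition flip (a : flag) := match a with EA => AE | AE => EA end.

Fixpoint sat (phi : form) (a : flag) (X : HSet) {struct phi} : Prop :=
  match phi with
  | FLTL psi =>
      match a with
      | EA => exists Y, X Y /\ forall chi, Y chi -> ltl_models chi psi
      | AE => forall Y, X Y -> exists chi, Y chi /\ ltl_models chi psi
      end
  | FNot f => ~ sat f (flip a) X
  | FAnd f1 f2 =>
      let ea := fun X' => forall X1 X2, par X' X1 X2 ->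
                  (nonempty X1 /\ sat f1 EA X1) \/ (nonempty X2 /\ sat f2 EA X2) in
      match a with EA => ea X | AE => ea (dual X) end
  | FOr f1 f2 =>
      let ae := fun X' => exists X1 X2, par X' X1 X2 /\
                  (nonempty X1 -> sat f1 AE X1) /\ (nonempty X2 -> sat f2 AE X2) in
      match a with AE => ae X | EA => ae (dual X) end
  | FEx p s f =>
      let ea := fun X' => sat f EA (ext_sigma s X' p) in
      match a with EA => ea X | AE => ea (dual X) end
  | FAll p s f =>
      let ae := fun X' => sat f AE (ext_sigma s X' p) in
      match a with AE => ae X | EA => ae (dual X) end
  end.

Definition alpha_satisfiable (a : flag) (phi : form) : Prop :=
  exists X, isHAsg X (free phi) /\ sat phi a X.

Definition satisfiable (phi : form) : Prop :=
  alpha_satisfiable EA phi /\ alpha_satisfiable AE phi.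

Definition sentence (phi : form) : Prop := forall q, ~ free phi q.

Inductive quant := QEx | QAll.

Definition prefix_form (pre : list (quant * AP * spec)) (psi : ltl) : form :=
  fold_right (fun x f => match x with
                         | (QEx, p, s) => FEx p s f
                         | (QAll, p, s) => FAll p s f
                         end) (FLTL psi) pre.

Definition behav (pre : list (quant * AP)) : list (quant * AP * spec) :=
  map (fun x => (fst x, snd x, specB)) pre.

Definition props_of (Q : quant) (pre : list (quant * AP)) : list AP :=
  map snd (filter (fun x => match fst x, Q with
                            | QEx, QEx | QAll, QAll => true
                            | _, _ => false end) pre).

Definition dual_quant (Q : quant) := match Q with QEx => QAll | QAll => QEx end.

(** Generic canonical form: the Q-quantified propositions first (in order, with B),
    then the other ones (in order), each with B \cup <{}, S> where S is the set of
    Q-quantified propositions occurring later in the prefix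
    (= q_i \cup ... \cup q_k for the block containing it). *)
Fixpoint tail_part (Q : quant) (pre : list (quant * AP)) : list (quant * AP * spec) :=
  match pre with
  | [] => []
  | x :: l =>
      if match fst x, Q with QEx, QEx | QAll, QAll => true | _, _ => false end
      then tail_part Q l
      else (fst x, snd x, spec_union specB (spec_empty_S (fun q => In q (props_of Q l))))
             :: tail_part Q l
  end.

Definition canon (Q : quant) (pre : list (quant * AP)) : list (quant * AP * spec) :=
  map (fun p => (Q, p, specB)) (props_of Q pre) ++ tail_part Q pre.

Definition C_EA := canon QEx.
Definition C_AE := canon QAll.

End GFG.

(* Main.v *)
(** All three sentences express that Eloise wins one and the same game of infinite duration:
    in round [t] the values at time [t] of the quantified propositions are chosen one after
    the other, in the order of the original prefix and by the owners of the quantifiers, and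
    Eloise wins if the resulting word satisfies [psi].

    A winning strategy of Eloise is turned into Skolem functors along the prefix. The
    invariant says that, for every way [a] of continuing the play on the propositions that are
    not quantified yet, some set of the hyperassignment (for [EA]; for [AE], every set)
    contains only (for [AE], contains at least one) assignments that extend to plays against
    [a] following the strategy. The specifications [B] and [tau_i] are those for which a
    functor reads exactly the moves made earlier in the game, whatever the order of
    quantification. A winning strategy of Abelard gives, in the same way, the truth of the
    dual sentence, which is the negation of the original one.

    So it remains to see that the game is determined. The truth set of an LTL formula is
    [Sigma^0_3]: by induction on the formula, its truth values are computed by a backward
    deterministic finite automaton whose runs on a given word separate after finitely many
    steps. Davis' theorem states that [Sigma^0_3] games are determined. *)

Require Import Defs.
From Stdlib Require Cantor.
From Stdlib Require Import List Arith Lia Classical ClassicalEpsilon.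
From Stdlib Require Import FunctionalExtensionality PropExtensionality.
Import ListNotations.
Set Implicit Arguments.

(** * Determinacy *)

(* Positions are stored with the most recent move at the head. *)
Fixpoint pref (x : nat -> bool) (k : nat) : list bool :=
  match k with 0 => [] | S k => x k :: pref x k end.

Lemma pref_length x k : length (pref x k) = k.
Proof. induction k; simpl; congruence. Qed.

Lemma pref_eq_le x y k j : pref x k = pref y k -> j <= k -> pref x j = pref y j.
Proof.
  intros H Hj. induction Hj as [|k Hj IH]; auto.
  apply IH. simpl in H. congruence.
Qed.

Lemma pref_eq_lt x y k j : pref x k = pref y k -> j < k -> x j = y j.
Proof.
  intros H Hj. apply (@pref_eq_le x y k (S j)) in H; [|lia].
  simpl in H. congruence.
Qed.

Lemma pref_app x k l v : pref x k = l ++ v -> v = pref x (length v).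
Proof.
  revert k; induction l as [|b l IH]; intros k H.
  - simpl in H. subst v. rewrite pref_length. reflexivity.
  - destruct k; simpl in H; [discriminate|]. injection H; intros. eapply IH; eauto.
Qed.

Lemma pref_split x k j : j <= k -> exists l, pref x k = l ++ pref x j.
Proof.
  induction 1 as [|k H [l IH]].
  - exists []; reflexivity.
  - exists (x k :: l). simpl. now rewrite IH.
Qed.

Lemma least (P : nat -> Prop) k :
  P k -> exists j, j <= k /\ P j /\ forall i, i < j -> ~ P i.
Proof.
  induction k as [k IH] using lt_wf_ind; intros H.
  destruct (classic (exists i, i < k /\ P i)) as [(i & Hi & Pi)|N].
  - destruct (IH i Hi Pi) as (j & ? & ?). exists j. split; [lia|auto].
  - exists k. split; [lia|split; auto]. intros i Hi Pi. apply N; eauto.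
Qed.

Section Determinacy.
(* [own k = true]: the [k]-th move belongs to player I. *)
Variable own : nat -> bool.

Definition tree := list bool -> Prop.

Definition follows (b : bool) (s : list bool -> bool) (k0 : nat) (x : nat -> bool) :=
  forall k, k0 <= k -> own k = b -> x k = s (pref x k).

Definition stays (T : tree) (k0 : nat) (x : nat -> bool) :=
  forall k, k0 <= k -> T (pref x k).

Definition wins (s : list bool -> bool) (T : tree) (A : (nat -> bool) -> Prop) (p : list bool) :=
  forall x, pref x (length p) = p -> follows true s (length p) x ->
    stays T (length p) x -> A x.

Definition win T A p := exists s, wins s T A p.

(** These trees are the nondeterministic strategies of player II: no move of player I is ever cut,
    and a play never gets stuck. *)
Definition quasi_strategy (T : tree) := forall u, T u ->
  (own (length u) = true -> forall b, T (b :: u)) /\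
  (own (length u) = false -> exists b, T (b :: u)).

(** * Composing strategies in stages *)

Section Staged.
Variables (stop : nat -> list bool -> Prop)
  (sig : nat -> list bool -> list bool -> bool) (p : list bool).

(** The memory of a composed strategy, recomputed from the position: how many stages have ended and
    where the current one began. [stop] is tested only strictly beyond [p]. *)
Fixpoint stage (u : list bool) : nat * list bool :=
  match u with
  | [] => (0, p)
  | b :: u' =>
      if le_dec (length u) (length p) then (0, p)
      else if excluded_middle_informative (stop (fst (stage u')) u)
      then (S (fst (stage u')), u) else stage u'
  end.

Definition staged u := sig (fst (stage u)) (snd (stage u)) u.

Lemma stage_start u : length u <= length p -> stage u = (0, p).
Proof.
  destruct u as [|b u]; auto. intros H. simpl. simpl in H.
  destruct le_dec; [auto|lia].
Qed.

Lemma stage_cons b u : length p <= length u -> stage (b :: u) =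
  if excluded_middle_informative (stop (fst (stage u)) (b :: u))
  then (S (fst (stage u)), b :: u) else stage u.
Proof.
  intros H. simpl. destruct le_dec; [lia|auto].
Qed.

(** The stage counter never decreases, so along a play it either becomes constant, and a single
    [sig n v] is followed from [v] on, or it takes every value. *)
Lemma staged_play x : pref x (length p) = p -> follows true staged (length p) x ->
  (exists n k, length p <= k /\
     (n = 0 /\ k = length p \/ exists m, n = S m /\ stop m (pref x k)) /\
     follows true (sig n (pref x k)) k x /\
     forall j, k < j -> ~ stop n (pref x j)) \/
  (forall n, exists k, length p <= k /\ stop n (pref x k)).
Proof.
  intros Hp Hx.
  set (reached n k := length p <= k /\ stage (pref x k) = (n, pref x k) /\
    (n = 0 /\ k = length p \/ exists m, n = S m /\ stop m (pref x k))).
  assert (const : forall n k, reached n k -> forall j, k <= j ->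
    (forall i, k < i -> i <= j -> ~ stop n (pref x i)) ->
    stage (pref x j) = (n, pref x k)).
  { intros n k (Hk & E & _) j Hj. induction Hj as [|j Hj IH]; intros N; auto.
    change (pref x (S j)) with (x j :: pref x j).
    rewrite stage_cons by (rewrite pref_length; lia).
    rewrite IH by (intros; apply N; lia). cbn [fst].
    destruct excluded_middle_informative as [s|]; auto.
    exfalso. apply (N (S j)); auto; lia. }
  destruct (classic (exists n k, reached n k /\ forall j, k < j -> ~ stop n (pref x j)))
    as [(n & k & Hr & N)|N].
  - left. exists n, k. destruct (Hr) as (Hk & E & H). repeat split; auto.
    intros j Hj Ho. rewrite (Hx j) by (auto; lia).
    unfold staged. rewrite (const n k Hr j) by auto. reflexivity.
  - right.
    assert (next : forall n k, reached n k -> exists j, reached (S n) j /\ stop n (pref x j)).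
    { intros n k Hr.
      assert (exists j, k < j /\ stop n (pref x j)) as (j0 & Hj0).
      { apply NNPP; intros M. apply N. exists n, k. split; auto.
        intros j Hj Hs. apply M; eauto. }
      destruct (least (fun j => k < j /\ stop n (pref x j)) j0 Hj0)
        as (j & _ & (Hj & Hs) & L).
      exists j. split; auto. destruct Hr as (Hk & E & H).
      split; [lia|split; [|eauto]].
      destruct j as [|j]; [lia|].
      change (pref x (S j)) with (x j :: pref x j) in *.
      rewrite stage_cons by (rewrite pref_length; lia).
      rewrite (const n k) by (try (split; auto; fail); try lia;
        intros i Hi Hi' Hn; apply (L i); auto; lia).
      cbn [fst]. destruct excluded_middle_informative; tauto. }
    assert (all : forall n, exists k, reached n k).
    { induction n as [|n [k IH]].
      - exists (length p). split; auto. split; auto.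
        rewrite stage_start by (rewrite pref_length; auto). now rewrite Hp.
      - destruct (next n k IH) as (j & Hj & _). eauto. }
    intros n. destruct (all n) as [k Hk]. destruct (next n k Hk) as (j & Hj & Hs).
    exists j. split; auto. apply Hj.
Qed.
End Staged.

(** Player I follows [s] until he meets a position from which he wins, and there changes to a
    winning strategy chosen by [epsilon]. *)
Lemma win_glue T A p :
  (exists s, wins s T (fun x => A x \/ exists k, length p <= k /\ win T A (pref x k)) p) ->
  win T A p.
Proof.
  intros [s Hs].
  (* [stop] is not tested at [p] itself, so a win at [p] is treated apart. *)
  destruct (classic (win T A p)) as [|Np]; auto.
  (* Only stage 0 can be stopped, so the strategy changes at most once. *)
  set (stop n u := n = 0 /\ win T A u).
  set (sig n (v : list bool) := match n with 0 => s | _ =>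
         epsilon (inhabits s) (fun s' => wins s' T A v) end).
  exists (staged stop sig p). intros x Hp Hf Hst.
  destruct (@staged_play stop sig p x Hp Hf) as [(n & k & Hk & H & Hfk & N)|H].
  - destruct n as [|n]; simpl in Hfk.
    + destruct H as [(_ & ->)|(m & ? & _)]; [|discriminate].
      destruct (Hs x Hp Hfk Hst) as [|(j & Hj & W)]; auto.
      destruct (Nat.eq_dec j (length p)) as [->|].
      * rewrite Hp in W. contradiction.
      * exfalso. apply (N j); [lia|]. split; auto.
    + destruct H as [(? & _)|(m & E & -> & W)]; [discriminate|].
      pose proof (epsilon_spec (inhabits s) (fun s' => wins s' T A (pref x k)) W) as Hw.
      apply Hw; rewrite ?pref_length; auto.
      intros j Hj. apply Hst. lia.
  - destruct (H 1) as (k & _ & E & _). discriminate.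
Qed.

Lemma win_I T A u b : own (length u) = true -> win T A (b :: u) -> win T A u.
Proof.
  intros Ho W. apply win_glue. exists (fun _ => b). intros x Hx Hf Hs. right.
  exists (S (length u)). split; [lia|]. simpl. rewrite Hx, (Hf (length u)); auto.
Qed.

Lemma win_II T A u : own (length u) = false ->
  (forall b, T (b :: u) -> win T A (b :: u)) -> win T A u.
Proof.
  intros Ho W. apply win_glue. exists (fun _ => true). intros x Hx Hf Hs. right.
  exists (S (length u)). split; [lia|].
  specialize (Hs (S (length u))). simpl in *. rewrite Hx in *. apply W, Hs. lia.
Qed.

Definition nonlosing (T : tree) A : tree := fun u => T u /\ ~ win T A u.

Lemma nonlosing_quasi T A : quasi_strategy T -> quasi_strategy (nonlosing T A).
Proof.
  intros Q u [Hu W]. destruct (Q u Hu) as [Q1 Q2]. split.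
  - intros Ho b. split; auto. intros Wb. apply W. eapply win_I; eauto.
  - intros Ho. apply NNPP; intros N. apply W, win_II; auto.
    intros b Hb. apply NNPP; intros Wb. apply N. exists b. split; auto.
Qed.

(** A play that stays in [T] but leaves [nonlosing T A] reaches a position from which player I wins
    in [T], and gluing applies. *)
Lemma win_nonlosing T A p : win (nonlosing T A) A p -> win T A p.
Proof.
  intros [s Hs]. apply win_glue. exists s. intros x Hx Hf Ht.
  destruct (classic (stays (nonlosing T A) (length p) x)) as [H|H]; [left; auto|right].
  apply NNPP; intros N. apply H. intros k Hk. split; auto.
  intros W. apply N. eauto.
Qed.

(** * Davis' lemma: avoiding one G_delta set *)

Section Davis.
Variables (A : (nat -> bool) -> Prop) (D : nat -> list bool -> Prop).

(** An arbitrary G_delta set: the cones of the positions in [D n] make up the [n]-th open set. *)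
Definition gdelta (x : nat -> bool) := forall n, exists k, D n (pref x k).

Hypothesis gdelta_sub : forall x, gdelta x -> A x.

(** A harmless restriction in the sense of Davis: player II gives up moves to be sure of avoiding
    the G_delta set, and player I gains no win from it. *)
Definition good (T : tree) (v : list bool) (U : tree) :=
  (forall u, U u -> T u) /\ quasi_strategy U /\ U v /\
  (forall x, pref x (length v) = v -> stays U (length v) x -> ~ gdelta x) /\
  ~ win U A v.

(** Closing [D n] under extension keeps the open set and allows a visit to be noticed late, after a
    prescribed length. *)
Definition entered n u := exists l v, u = l ++ v /\ D n v.

Lemma entered_pref n x k : entered n (pref x k) -> exists j, D n (pref x j).
Proof.
  intros (l & v & E & H). exists (length v). now rewrite <- (pref_app _ _ _ _ E).
Qed.

Lemma entered_later n x k j : D n (pref x k) -> k <= j -> entered n (pref x j).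
Proof.
  intros H Hj. destruct (pref_split x Hj) as [l E]. exists l, (pref x k). auto.
Qed.

Section Switch.
Variables (T : tree) (v : list bool) (n : nat).
Hypotheses (qT : quasi_strategy T) (Tv : T v).

Let target (x : nat -> bool) :=
  A x \/ exists j, length v < j /\ (~ exists U, good T (pref x j) U) /\ entered n (pref x j).

Let base := nonlosing T target.

Fixpoint switched (u : list bool) : option (list bool) :=
  match u with
  | [] => None
  | b :: u' => match switched u' with
      | Some w => Some w
      | None => if excluded_middle_informative (length v < length u /\ entered n u)
                then Some u else None
      end
  end.

Let witness w := epsilon (inhabits T) (good T w).

(* II avoids [target] until [D n] is entered, and then uses a witness that the position
   reached is good. *)
Let switch_tree : tree := fun u =>
  match switched u with
  | None => base u
  | Some w => (exists U, good T w U) /\ witness w u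
  end.

Lemma switched_keep x i j w :
  switched (pref x i) = Some w -> i <= j -> switched (pref x j) = Some w.
Proof.
  intros E H. induction H as [|j H IH]; auto. simpl. now rewrite IH.
Qed.

Lemma switched_some x j w : switched (pref x j) = Some w ->
  exists i, length v < i /\ i <= j /\ w = pref x i /\ entered n (pref x i) /\
    switched (pref x i) = Some w /\
    forall j', j' < i -> switched (pref x j') = None.
Proof.
  induction j as [|j IH]; intros E; [discriminate|].
  destruct (switched (pref x j)) as [w'|] eqn:E'.
  - pose proof (@switched_keep x j (S j) w' E' ltac:(lia)) as E2.
    assert (w' = w) by congruence. subst w'.
    destruct (IH eq_refl) as (i & H). exists i. intuition lia.
  - pose proof E as E2. cbn [pref switched] in E2. rewrite E' in E2.
    destruct excluded_middle_informative as [[H1 H2]|]; [|discriminate].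
    injection E2; intros <-. exists (S j).
    cbn [length] in H1. rewrite pref_length in H1.
    repeat split; auto.
    intros j' Hj'. destruct (switched (pref x j')) as [w'|] eqn:E3; auto.
    rewrite (@switched_keep x j' j w' E3 ltac:(lia)) in E'. discriminate.
Qed.

Lemma switched_short u : length u <= length v -> switched u = None.
Proof.
  induction u as [|b u IH]; intros H; auto. simpl in *. rewrite IH by lia.
  destruct excluded_middle_informative; [lia|auto].
Qed.

(** Otherwise player I has attained [target] at [u], whatever is played afterwards; hence the
    constant strategy. *)
Lemma base_good u : base u -> length v < length u -> entered n u -> exists U, good T u U.
Proof.
  intros [Hu W] Hl He. apply NNPP; intros N. apply W. exists (fun _ => true).
  intros x Hx _ _. right. exists (length u). rewrite Hx. auto.
Qed.

Lemma witness_good w : (exists U, good T w U) -> good T w (witness w).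
Proof. apply epsilon_spec. Qed.

Lemma switch_quasi : quasi_strategy switch_tree.
Proof.
  assert (qB : quasi_strategy base) by (apply nonlosing_quasi; auto).
  intros u Hu. unfold switch_tree in *. simpl.
  destruct (switched u) as [w|] eqn:E.
  - destruct Hu as [G Hu]. destruct (witness_good G) as (_ & Q & _).
    destruct (Q u Hu) as [Q1 Q2]. split; auto.
    intros Ho. destruct (Q2 Ho) as [b Hb]. eauto.
  - assert (K : forall b, base (b :: u) ->
      match (if excluded_middle_informative (length v < S (length u) /\ entered n (b :: u))
             then Some (b :: u) else None) with
      | Some w => (exists U, good T w U) /\ witness w (b :: u)
      | None => base (b :: u)
      end).
    { intros b Hb. destruct excluded_middle_informative as [[H1 H2]|]; auto.
      pose proof (base_good Hb H1 H2) as G. split; auto. apply (witness_good G). }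
    destruct (qB u Hu) as [Q1 Q2]. split.
    + intros Ho b. apply K; auto.
    + intros Ho. destruct (Q2 Ho) as [b Hb]. exists b. apply K; auto.
Qed.

(** A play in [gdelta] enters [D n] and so continues in a witness, which excludes [gdelta]. A
    strategy winning [A] on [switch_tree] would win [target] on [base]: without a switch the play
    belongs to both trees, and with one the strategy would win on a witness, which is impossible. *)
Lemma switch_good : ~ win T target v -> good T v switch_tree.
Proof.
  intros NW.
  assert (NB : ~ win base target v) by (intros W; apply NW, win_nonlosing, W).
  split; [|split; [apply switch_quasi|split; [|split]]].
  - intros u. unfold switch_tree. destruct (switched u) as [w|].
    + intros [G Hu]. destruct (witness_good G) as (S & _). auto.
    + intros [Hu _]. auto.
  - unfold switch_tree. rewrite switched_short by auto. split; auto.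
  - intros x Hx Hs B. destruct (B n) as [k Hk].
    (* Late enough to lie both beyond [v] and after the visit to [D n] at time [k]. *)
    set (j := k + S (length v)).
    assert (He : entered n (pref x j)) by (eapply entered_later; eauto; lia).
    assert (exists w, switched (pref x j) = Some w) as [w Ew].
    { unfold j in *. rewrite Nat.add_succ_r in *. cbn [pref switched] in *.
      destruct (switched (pref x (k + length v))); eauto.
      destruct excluded_middle_informative as [|N]; eauto.
      exfalso. apply N. split; auto. simpl. rewrite pref_length. lia. }
    destruct (@switched_some _ _ _ Ew) as (i & Hi & Hij & -> & _ & Ei & _).
    assert (Hw : forall j', i <= j' ->
      (exists U, good T (pref x i) U) /\ witness (pref x i) (pref x j')).
    { intros j' Hj'. specialize (Hs j' ltac:(lia)). unfold switch_tree in Hs.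
      rewrite (@switched_keep x i j' _ Ei Hj') in Hs. auto. }
    destruct (Hw i (le_n _)) as [G _].
    destruct (witness_good G) as (_ & _ & _ & Bd & _).
    apply (Bd x); auto; rewrite pref_length; auto. intros j' Hj'. apply Hw; auto.
  - intros [s Hs]. apply NB. exists s. intros x Hx Hf Hst.
    destruct (classic (exists j w, switched (pref x j) = Some w)) as [(j & w & Ew)|N].
    + exfalso.
      destruct (@switched_some _ _ _ Ew) as (i & Hi & Hij & -> & He & Ei & Li).
      assert (G : exists U, good T (pref x i) U).
      { apply base_good; rewrite ?pref_length; auto. apply Hst. lia. }
      destruct (witness_good G) as (_ & _ & _ & _ & NWi). apply NWi.
      (* A play [y] of the witness through [pref x i] agrees with [x] before time [i], so it is a
         play of [switch_tree] that follows [s]. *)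
      exists s. intros y Hy Hfy Hsy. rewrite pref_length in *.
      apply Hs.
      * rewrite (@pref_eq_le y x i) by (auto; lia). auto.
      * intros k Hk Ho. destruct (le_lt_dec i k); auto.
        rewrite (@pref_eq_lt y x i), (@pref_eq_le y x i) by (auto; lia). auto.
      * intros k Hk. unfold switch_tree. destruct (le_lt_dec i k).
        -- rewrite (@switched_keep y i k (pref x i)); auto.
           now rewrite Hy.
        -- rewrite (@pref_eq_le y x i k), Li by (auto; lia). apply Hst; auto.
    + left. apply Hs; auto. intros k Hk. unfold switch_tree.
      destruct (switched (pref x k)) eqn:E; [exfalso; eauto|]. apply Hst; auto.
Qed.

Lemma not_good_win : (~ exists U, good T v U) -> win T target v.
Proof.
  intros N. apply NNPP; intros W. apply N. exists switch_tree. now apply switch_good.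
Qed.
End Switch.

(* If [p] were not good, I would win [A]: he wins [target 0] until a position that is not good
   and lies in [D 0], from there [target 1], and so on; a play that goes through all stages
   is in [gdelta]. *)
Lemma davis_good T p : quasi_strategy T -> T p -> ~ win T A p -> exists U, good T p U.
Proof.
  intros qT Tp NW. apply NNPP; intros N. apply NW.
  set (stop n u := (~ exists U, good T u U) /\ entered n u).
  set (target n (v : list bool) x := A x \/ exists j, length v < j /\ stop n (pref x j)).
  set (sig n v := epsilon (inhabits (fun _ : list bool => true))
         (fun s => wins s T (target n v) v)).
  exists (staged stop sig p). intros x Hp Hf Hst.
  destruct (@staged_play stop sig p x Hp Hf) as [(n & k & Hk & H & Hfk & L)|H].
  (* Every stage starts at a position that is not good, so the strategy chosen for it really wins
     its target. *)
  - assert (Ng : ~ exists U, good T (pref x k) U).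
    { destruct H as [(_ & ->)|(m & _ & (? & _))]; auto. rewrite Hp; auto. }
    assert (W : win T (target n (pref x k)) (pref x k))
      by (apply not_good_win; auto; apply Hst; auto).
    pose proof (epsilon_spec (inhabits (fun _ : list bool => true)) _ W) as Hw.
    destruct (Hw x) as [|(j & Hj & Hs)]; rewrite ?pref_length in *; auto.
    + intros j Hj. apply Hst. lia.
    + exfalso. apply (L j); auto.
  - apply gdelta_sub. intros n. destruct (H n) as (k & _ & _ & He).
    eapply entered_pref; eauto.
Qed.

(** Cutting the tree down to its [nonlosing] part extends the absence of a win from [p] to all
    positions, so that the refinement can be repeated later in the play. *)
Lemma davis_refine T p : quasi_strategy T -> T p -> ~ win T A p ->
  exists U : tree, (forall u, U u -> T u) /\ quasi_strategy U /\ U p /\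
    (forall x, pref x (length p) = p -> stays U (length p) x -> ~ gdelta x) /\
    forall u, U u -> ~ win U A u.
Proof.
  intros qT Tp NW. destruct (davis_good qT Tp NW) as (U & S & Q & Up & Bd & W).
  exists (nonlosing U A). split; [|split; [|split; [|split]]].
  - intros u [? _]. auto.
  - now apply nonlosing_quasi.
  - split; auto.
  - intros x Hx Hs. apply Bd; auto. intros k Hk. apply Hs; auto.
  - intros u [_ Hu] Wu. apply Hu, win_nonlosing, Wu.
Qed.
End Davis.

(** * Determinacy of Sigma^0_3 games *)

Definition sigma3 (A : (nat -> bool) -> Prop) :=
  exists D : nat -> nat -> list bool -> Prop,
    forall x, A x <-> exists i, forall n, exists k, D i n (pref x k).

Theorem sigma3_determined A : sigma3 A ->
  (exists s, forall x, follows true s 0 x -> A x) \/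
  (exists s, forall x, follows false s 0 x -> ~ A x).
Proof.
  intros [D HD].
  destruct (classic (win (fun _ => True) A [])) as [[s Hs]|NW].
  { left. exists s. intros x Hx. apply Hs; auto. intros k _. exact I. }
  right.
  set (refined i p (T U : tree) := (forall u, U u -> T u) /\ quasi_strategy U /\ U p /\
    (forall x, pref x (length p) = p -> stays U (length p) x -> ~ gdelta (D i) x) /\
    forall u, U u -> ~ win U A u).
  (* Shrinking the tree at the [i]-th move to avoid the [i]-th [gdelta] set leaves, in the
     limit, a strategy of II avoiding all of them. *)
  set (ref i p T := epsilon (inhabits T) (refined i p T)).
  assert (Href : forall i p T, quasi_strategy T -> T p -> ~ win T A p -> refined i p T (ref i p T)).
  { intros i p T Q Tp W. apply epsilon_spec. apply davis_refine; auto.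
    intros x Hx. apply HD. exists i. auto. }
  (* The tree at a position of length [k] refines that of its predecessor against the [k]-th G_delta
     set. *)
  set (tr := fix tr u : tree := match u with
     | [] => ref 0 [] (fun _ => True)
     | b :: u' => ref (length u) u (tr u') end).
  set (s u := epsilon (inhabits true) (fun b => tr u (b :: u))).
  exists s. intros x Hx.
  assert (inv : forall k, exists T : tree, refined k (pref x k) T (tr (pref x k)) /\
     forall j, j < k -> forall u, T u -> tr (pref x j) u).
  { induction k as [|k (T & (S & Q & Tp & Bd & W) & Sub)].
    - exists (fun _ => True). split; [|intros; lia].
      apply Href; auto. intros u _. split; auto. exists true; auto.
    - exists (tr (pref x k)).
      assert (Hn : tr (pref x k) (pref x (Datatypes.S k))).
      { destruct (Q _ Tp) as [Q1 Q2]. rewrite pref_length in *. simpl.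
        destruct (own k) eqn:Ho; auto.
        rewrite (Hx k) by (auto; lia).
        apply (epsilon_spec (inhabits true) (fun b => tr (pref x k) (b :: pref x k))); auto. }
      split.
      + replace (Datatypes.S k) with (length (pref x (Datatypes.S k))) at 1
          by apply pref_length.
        apply Href; auto.
      + intros j Hj u Hu. destruct (Nat.eq_dec j k) as [->|]; auto.
        apply Sub; auto. lia. }
  intros Ax. apply HD in Ax. destruct Ax as [i Hi].
  destruct (inv i) as (T & (_ & _ & _ & Bd & _) & _).
  apply (Bd x); auto; rewrite pref_length; auto.
  (* Later trees are contained in the [i]-th one, so the play stays in it from time [i] on. *)
  intros k Hk. destruct (inv k) as (T' & (S & _ & Tp & _) & Sub).
  destruct (Nat.eq_dec i k) as [->|]; auto.
  apply (Sub i); auto. lia.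
Qed.
End Determinacy.

(** * LTL truth sets *)

(** Clopen sets of Cantor space; one implication suffices because [x] and [y] are
    interchangeable. *)
Definition determined_by_prefix (A : (nat -> bool) -> Prop) :=
  exists k, forall x y, pref x k = pref y k -> A x -> A y.

(** * Closure properties of Sigma^0_3 sets *)

Lemma sigma3_equiv (A B : (nat -> bool) -> Prop) :
  (forall x, A x <-> B x) -> sigma3 A -> sigma3 B.
Proof.
  intros E [D H]. exists D. intros x. now rewrite <- E.
Qed.

Lemma sigma3_forall_exists (P : nat -> nat -> (nat -> bool) -> Prop) :
  (forall m M, determined_by_prefix (P m M)) -> sigma3 (fun x => forall m, exists M, P m M x).
Proof.
  intros HP.
  (* The positions whose cone lies inside some [P m M]; the union index is a dummy, since the set is
     already G_delta. *)
  exists (fun _ m u => exists M, forall y, pref y (length u) = u -> P m M y).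
  intros x. split.
  - intros H. exists 0. intros m. destruct (H m) as [M HM].
    destruct (HP m M) as [k Hk]. exists k, M. intros y Hy.
    rewrite pref_length in Hy. apply (Hk x y); auto.
  - intros [_ H] m. destruct (H m) as (k & M & HM). exists M.
    apply HM. now rewrite pref_length.
Qed.

Lemma sigma3_prefix A : determined_by_prefix A -> sigma3 A.
Proof.
  intros H. apply (@sigma3_equiv (fun x => forall _ : nat, exists _ : nat, A x)).
  - intros x. split; [intros K; destruct (K 0); auto|intros K _; exists 0; auto].
  - apply sigma3_forall_exists. auto.
Qed.

Lemma sigma3_exists (A : nat -> (nat -> bool) -> Prop) :
  (forall i, sigma3 (A i)) -> sigma3 (fun x => exists i, A i x).
Proof.
  intros H. apply choice in H. destruct H as [D HD].
  exists (fun i => D (fst (Cantor.of_nat i)) (snd (Cantor.of_nat i))).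
  intros x. split.
  - intros [i Hi]. apply HD in Hi. destruct Hi as [j Hj].
    exists (Cantor.to_nat (i, j)). now rewrite Cantor.cancel_of_to.
  - intros [i Hi]. exists (fst (Cantor.of_nat i)). apply HD. eauto.
Qed.

Lemma sigma3_or A B : sigma3 A -> sigma3 B -> sigma3 (fun x => A x \/ B x).
Proof.
  intros HA HB.
  apply (@sigma3_equiv (fun x => exists i, match i with 0 => A | _ => B end x)).
  - intros x. split.
    + intros [[|i] H]; auto.
    + intros [H|H]; [exists 0|exists 1]; auto.
  - apply sigma3_exists. intros [|i]; auto.
Qed.

Lemma sigma3_and A B : sigma3 A -> sigma3 B -> sigma3 (fun x => A x /\ B x).
Proof.
  intros [D HD] [E HE].
  (* [i] codes one index for each union; the second component of the pair coded by [n] tells which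
     of the two sequences of open sets is meant. *)
  exists (fun i n => match snd (Cantor.of_nat n) with
    | 0 => D (fst (Cantor.of_nat i)) (fst (Cantor.of_nat n))
    | _ => E (snd (Cantor.of_nat i)) (fst (Cantor.of_nat n)) end).
  intros x. rewrite HD, HE. split.
  - intros [[i Hi] [j Hj]]. exists (Cantor.to_nat (i, j)).
    rewrite Cantor.cancel_of_to. intros n. simpl.
    destruct (snd (Cantor.of_nat n)); auto.
  - intros [i Hi]. split; [exists (fst (Cantor.of_nat i))|exists (snd (Cantor.of_nat i))];
    intros n.
    + specialize (Hi (Cantor.to_nat (n, 0))). now rewrite Cantor.cancel_of_to in Hi.
    + specialize (Hi (Cantor.to_nat (n, 1))). now rewrite Cantor.cancel_of_to in Hi.
Qed.

Lemma sigma3_const (P : Prop) : sigma3 (fun _ => P).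
Proof. apply sigma3_prefix. exists 0. auto. Qed.

Lemma sigma3_bounded (A : nat -> (nat -> bool) -> Prop) i j :
  (forall k, sigma3 (A k)) -> sigma3 (fun x => forall k, i <= k -> k < j -> A k x).
Proof.
  intros H. induction j as [|j IH].
  - apply (@sigma3_equiv (fun _ => True)); [|apply sigma3_const].
    split; auto. intros _ k _ Hk. lia.
  - apply (@sigma3_equiv (fun x => (forall k, i <= k -> k < j -> A k x) /\
       (i <= j -> A j x))).
    + intros x. split.
      * intros [H1 H2] k Hk Hk'. destruct (Nat.eq_dec k j) as [->|]; auto.
        apply H1; lia.
      * intros K. split; intros; apply K; lia.
    + apply sigma3_and; auto.
      destruct (le_dec i j) as [L|L].
      * apply (@sigma3_equiv (A j)); auto. tauto.
      * apply (@sigma3_equiv (fun _ => True)); [tauto|apply sigma3_const].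
Qed.

Lemma sigma3_list (Q : Type) (l : list Q) (A : Q -> (nat -> bool) -> Prop) :
  (forall q, sigma3 (A q)) -> sigma3 (fun x => exists q, In q l /\ A q x).
Proof.
  intros H. induction l as [|q l IH].
  - apply (@sigma3_equiv (fun _ => False)); [|apply sigma3_const].
    intros x. split; [tauto|intros (q & [] & _)].
  - apply (@sigma3_equiv (fun x => A q x \/ exists q, In q l /\ A q x)).
    + intros x. split.
      * intros [K|(q' & K & K')]; [exists q|exists q']; simpl; auto.
      * intros (q' & [->|K] & K'); eauto.
    + apply sigma3_or; auto.
Qed.

(** * Backward deterministic automata for LTL *)

Section Words.
Variables (AP : Type) (word : (nat -> bool) -> nat -> AP -> bool).
Hypothesis word_prefix : forall t, exists k, forall x y, pref x k = pref y k ->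
  word x t = word y t.

(* [T x i] is the state at time [i] of a backward deterministic automaton reading [word x]. *)
Definition codet (Q : Type) (l : list Q) (delta : (AP -> bool) -> Q -> Q)
    (T : (nat -> bool) -> nat -> Q) :=
  (forall q, In q l) /\
  (forall x i, T x i = delta (word x i) (T x (S i))) /\
  (forall i q, sigma3 (fun x => T x i = q)).

Lemma codet_state Q l delta T (P : Q -> Prop) i :
  @codet Q l delta T -> sigma3 (fun x => P (T x i)).
Proof.
  intros (Hl & _ & H).
  apply (@sigma3_equiv (fun x => exists q, In q l /\ (T x i = q /\ P q))).
  - intros x. split.
    + intros (q & _ & <- & H'). auto.
    + eauto.
  - apply sigma3_list. intros q. apply sigma3_and; auto. apply sigma3_const.
Qed.

Lemma codet_prod Q1 l1 d1 T1 Q2 l2 d2 T2 :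
  @codet Q1 l1 d1 T1 -> @codet Q2 l2 d2 T2 ->
  codet (list_prod l1 l2) (fun a q => (d1 a (fst q), d2 a (snd q)))
    (fun x i => (T1 x i, T2 x i)).
Proof.
  intros (H1 & E1 & S1) (H2 & E2 & S2). split; [|split].
  - intros [q1 q2]. apply in_prod; auto.
  - intros x i. simpl. now rewrite E1, E2.
  - intros i [q1 q2]. apply (@sigma3_equiv (fun x => T1 x i = q1 /\ T2 x i = q2)).
    + intros x. split; [intros [-> ->]|intros H; injection H]; auto.
    + apply sigma3_and; auto.
Qed.

(** The new bit may depend on its own next value, as the truth value of an until does. Both values
    are assumed [sigma3] because this class is not closed under complement. *)
Lemma codet_bool Q l d T (U : (nat -> bool) -> nat -> bool) g :
  @codet Q l d T ->
  (forall x i, U x i = g (word x i) (T x (S i)) (U x (S i))) ->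
  (forall i b, sigma3 (fun x => U x i = b)) ->
  codet (list_prod l [true; false]) (fun a q => (d a (fst q), g a (fst q) (snd q)))
    (fun x i => (T x i, U x i)).
Proof.
  intros (H1 & E1 & S1) E2 S2. split; [|split].
  - intros [q1 q2]. apply in_prod; auto. destruct q2; simpl; auto.
  - intros x i. simpl. now rewrite E1, E2.
  - intros i [q1 q2]. apply (@sigma3_equiv (fun x => T x i = q1 /\ U x i = q2)).
    + intros x. split; [intros [-> ->]|intros H; injection H]; auto.
    + apply sigma3_and; auto.
Qed.

Section Always.
Variables (Q : Type) (l : list Q) (delta : (AP -> bool) -> Q -> Q)
  (T : (nat -> bool) -> nat -> Q).
Hypothesis HT : codet l delta T.

Fixpoint back x i d q :=
  match d with 0 => q | S d => delta (word x i) (back x (S i) d q) end.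

Lemma back_state x i d : back x i d (T x (i + d)) = T x i.
Proof.
  destruct HT as (_ & E & _). revert i. induction d as [|d IH]; intros i; simpl.
  - now rewrite Nat.add_0_r.
  - rewrite <- Nat.add_succ_comm, IH. now rewrite <- E.
Qed.

Lemma back_add x i d e q : back x i (d + e) q = back x i d (back x (i + d) e q).
Proof.
  revert i. induction d as [|d IH]; intros i; simpl.
  - now rewrite Nat.add_0_r.
  - now rewrite IH, <- Nat.add_succ_comm.
Qed.

Lemma back_prefix i d : exists k, forall x y, pref x k = pref y k ->
  forall q, back x i d q = back y i d q.
Proof.
  revert i. induction d as [|d IH]; intros i.
  - exists 0. auto.
  - destruct (IH (S i)) as [k Hk], (word_prefix i) as [k' Hk'].
    exists (max k k'). intros x y E q. simpl.
    rewrite (Hk x y), (Hk' x y); auto; eapply pref_eq_le; eauto; lia.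
Qed.

Variable B : Q -> Prop.

(** Under [safe n q], a finite look-ahead [e] certifies [B] at time [n + m] for all runs in state
    [q] at time [n]. Ranging over all end states [q'] makes each [step] depend on finitely many
    letters, so [safe] is G_delta even if no prefix determines the actual run [T]. *)
Let step n q m e x := forall q', B (back x (n + m) e q') \/ back x n (m + e) q' <> q.
Let safe n q x := forall m, exists e, step n q m e x.

Lemma safe_sigma3 n q : sigma3 (safe n q).
Proof.
  apply sigma3_forall_exists. intros m e.
  destruct (back_prefix (n + m) e) as [k1 H1], (back_prefix n (m + e)) as [k2 H2].
  exists (max k1 k2). intros x y E H q'.
  rewrite <- (H1 x y), <- (H2 x y); auto; eapply pref_eq_le; eauto; lia.
Qed.

(* Distinct runs stay distinct once they differ, so at most [length l] of them exist;
   past the position where all of them have separated, the current state fixes the run. *)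
Lemma safe_eventually x i :
  (forall j, i <= j -> B (T x j)) -> exists n, safe (i + n) (T x (i + n)) x.
Proof.
  intros HB. apply NNPP; intros N.
  assert (F : forall n, exists m, forall e, exists q',
     ~ B (back x (i + n + m) e q') /\ back x (i + n) (m + e) q' = T x (i + n)).
  { intros n. apply NNPP; intros M. apply N. exists n. intros m.
    apply NNPP; intros Me. apply M. exists m. intros e.
    apply NNPP; intros Mq. apply Me. exists e. intros q'.
    destruct (classic (B (back x (i + n + m) e q'))); auto. right. eauto. }
  apply choice in F. destruct F as [f Hf].
  set (pos := fix pos K := match K with 0 => 0 | S K => pos K + f (pos K) end).
  (* [K] failures of [safe] yield, for every look-ahead, [K] different end states whose runs miss
     the actual one at time [i + pos K]. *)
  assert (C : forall K e, exists L, NoDup L /\ length L = K /\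
     forall r, In r L -> back x (i + pos K) e r <> T x (i + pos K)).
  { induction K as [|K IH]; intros e.
    - exists []. split; [constructor|split; auto].
    - destruct (IH (f (pos K) + e)) as (L & ND & Hl & HL).
      destruct (Hf (pos K) e) as (q' & Hq1 & Hq2).
      (* The run of [q'] meets the actual one at [i + pos K], which those of [L] do not, so [q'] is
         new. It then violates [B] at [i + pos (S K)], where the actual run satisfies it. *)
      exists (q' :: L). split; [|split].
      + constructor; auto. intros Hin. now apply (HL q').
      + simpl. now rewrite Hl.
      + simpl. rewrite Nat.add_assoc. intros r [<-|Hr] E.
        * apply Hq1. rewrite E. apply HB. lia.
        * apply (HL r Hr). rewrite back_add, E. apply back_state. }
  destruct (C (S (length l)) 0) as (L & ND & Hl & _).
  assert (K : length L <= length l).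
  { apply NoDup_incl_length; auto. intros q _. apply HT. }
  lia.
Qed.

(** Finitely many times are checked directly, and from [i + n] on [safe] takes over; such an [n]
    exists by [safe_eventually]. *)
Lemma always_sigma3 i : sigma3 (fun x => forall j, i <= j -> B (T x j)).
Proof.
  apply (@sigma3_equiv (fun x => exists n,
    (forall k, i <= k -> k < i + n -> B (T x k)) /\
    exists q, In q l /\ (T x (i + n) = q /\ safe (i + n) q x))).
  - intros x. split.
    + intros (n & H & q & _ & Hq & S) j Hj.
      destruct (le_lt_dec (i + n) j) as [L|L]; auto.
      destruct (S (j - (i + n))) as [e He].
      replace j with (i + n + (j - (i + n))) by lia.
      set (m := j - (i + n)) in *.
      (* The look-ahead is applied to the end state of the actual run. *)
      destruct (He (T x (i + n + m + e))) as [K|K].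
      * now rewrite back_state in K.
      * exfalso. apply K. rewrite <- Nat.add_assoc, back_state. auto.
    + intros H. destruct (@safe_eventually x i H) as [n Hn]. exists n. split; auto.
      exists (T x (i + n)). split; auto. apply HT.
  - apply sigma3_exists. intros n. apply sigma3_and.
    + apply sigma3_bounded. intros k. eapply codet_state; eauto.
    + apply sigma3_list. intros q. apply sigma3_and; [apply HT|apply safe_sigma3].
Qed.
End Always.

Definition recognized (P : (nat -> bool) -> nat -> Prop) :=
  exists Q l delta T (val : Q -> bool), codet l delta T /\
    forall x i, P x i <-> val (T x i) = true.

Lemma recognized_sigma3 P i : recognized P -> sigma3 (fun x => P x i).
Proof.
  intros (Q & l & d & T & val & H & E).
  apply (@sigma3_equiv (fun x => val (T x i) = true)).
  - intros x. now rewrite E.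
  - exact (@codet_state Q l d T (fun q => val q = true) i H).
Qed.

(** At the first time at which [A /\ ~ B] fails, [B] fails too, since otherwise the until would
    hold; hence so does [A]. *)
Lemma not_until (A B : nat -> Prop) i :
  ~ (exists j, i <= j /\ B j /\ forall k, i <= k -> k < j -> A k) <->
  (exists j, i <= j /\ ~ A j /\ forall k, i <= k -> k < S j -> ~ B k) \/
  (forall j, i <= j -> A j /\ ~ B j).
Proof.
  split.
  - intros N. destruct (classic (exists j, i <= j /\ ~ (A j /\ ~ B j))) as [[j Hj]|M].
    + destruct (least (fun j => i <= j /\ ~ (A j /\ ~ B j)) j Hj)
        as (k & _ & (Hik & Hk) & L).
      assert (L' : forall k', i <= k' -> k' < k -> A k' /\ ~ B k').
      { intros k' H1 H2. apply NNPP. intros M. now apply (L k'). }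
      assert (~ B k).
      { intros Bk. apply N. exists k. repeat split; auto. intros. now apply L'. }
      left. exists k. repeat split; auto.
      intros k' H1 H2. destruct (Nat.eq_dec k' k) as [->|]; auto. apply L'; auto. lia.
    + right. intros j Hj. apply NNPP; intros K. eauto.
  - intros [(j & Hj & NA & NB)|H] (j' & Hj' & Bj & HA).
    + destruct (le_lt_dec j' j).
      * apply (NB j'); auto. lia.
      * now apply NA, HA.
    + now apply (H j').
Qed.

(** The acceptance map is separate from the automaton, so negation only changes [val]. Conjunction
    and disjunction use products; next and until add a bit holding their truth value. *)
Lemma ltl_recognized (psi : ltl AP) : recognized (fun x i => ltl_sat (word x) psi i).
Proof.
  induction psi as [q| |a IH|a IHa b IHb|a IHa b IHb|a IH|a IHa b IHb].
  - exists bool, [true; false], (fun w _ => w q), (fun x i => word x i q), (fun b => b).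
    split; [split; [|split]|simpl; tauto].
    + intros []; simpl; auto.
    + auto.
    + intros i b. apply sigma3_prefix. destruct (word_prefix i) as [k Hk].
      exists k. intros x y E <-. now rewrite (Hk x y E).
  - exists unit, [tt], (fun _ _ => tt), (fun _ _ => tt), (fun _ => true).
    split; [split; [|split]|simpl; tauto].
    + intros []; simpl; auto.
    + auto.
    + intros i q. apply sigma3_const.
  - destruct IH as (Q & l & d & T & val & H & E).
    exists Q, l, d, T, (fun q => negb (val q)). split; auto.
    intros x i. simpl. rewrite E. destruct (val (T x i)); simpl; intuition congruence.
  - destruct IHa as (Q & l & d & T & val & H & E), IHb as (Q' & l' & d' & T' & val' & H' & E').
    eexists _, _, _, _, (fun q => andb (val (fst q)) (val' (snd q))).
    split; [exact (codet_prod H H')|].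
    intros x i. simpl. now rewrite E, E', Bool.andb_true_iff.
  - destruct IHa as (Q & l & d & T & val & H & E), IHb as (Q' & l' & d' & T' & val' & H' & E').
    eexists _, _, _, _, (fun q => orb (val (fst q)) (val' (snd q))).
    split; [exact (codet_prod H H')|].
    intros x i. simpl. now rewrite E, E', Bool.orb_true_iff.
  - destruct IH as (Q & l & d & T & val & H & E).
    eexists _, _, _, _, (fun q => snd q).
    split; [refine (@codet_bool _ _ _ _ (fun x i => val (T x (S i)))
              (fun _ q _ => val q) H _ _)|].
    + auto.
    + intros i b. exact (codet_state (fun q => val q = b) (S i) H).
    + intros x i. simpl. apply E.
  - pose proof (fun i => @recognized_sigma3 _ i IHa) as Sa.
    pose proof (fun i => @recognized_sigma3 _ i IHb) as Sb.
    destruct IHa as (Q & l & d & T & val & H & E), IHb as (Q' & l' & d' & T' & val' & H' & E').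
    pose proof (codet_prod H H') as HP.
    set (until x i := ltl_sat (word x) (LUntil a b) i).
    set (U x i := if excluded_middle_informative (until x i) then true else false).
    assert (HU : forall x i, until x i <-> U x i = true).
    { intros x i. unfold U. destruct excluded_middle_informative; intuition congruence. }
    assert (St : forall i, sigma3 (fun x => until x i)).
    { intros i. apply sigma3_exists. intros j.
      apply sigma3_and; [apply sigma3_const|apply sigma3_and; auto].
      apply sigma3_bounded. auto. }
    assert (Sn : forall i, sigma3 (fun x => ~ until x i)).
    { intros i. eapply sigma3_equiv; [intros x; symmetry; apply not_until|].
      apply sigma3_or.
      - apply sigma3_exists. intros j.
        apply sigma3_and; [apply sigma3_const|apply sigma3_and].
        + apply (@sigma3_equiv (fun x => ~ val (T x j) = true)).
          * intros x. now rewrite E.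
          * exact (codet_state (fun q => ~ val q = true) j H).
        + apply sigma3_bounded. intros k.
          apply (@sigma3_equiv (fun x => ~ val' (T' x k) = true)).
          * intros x. now rewrite E'.
          * exact (codet_state (fun q => ~ val' q = true) k H').
      - apply (@sigma3_equiv (fun x => forall j, i <= j ->
          val (T x j) = true /\ ~ val' (T' x j) = true)).
        + intros x. split; intros K j Hj; specialize (K j Hj);
            [rewrite E, E'|rewrite E, E' in K]; auto.
        + exact (always_sigma3 HP (fun q => val (fst q) = true /\ ~ val' (snd q) = true) i). }
    (* The bit follows the unfolding law of until; the current truth values of [a] and [b] come from
       one transition applied to the next states. *)
    eexists _, _, _, _, (fun q => snd q).
    split; [refine (@codet_bool _ _ _ _ U
       (fun w q u => orb (val' (d' w (snd q))) (andb (val (d w (fst q))) u)) HP _ _)|].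
    + intros x i. cbn [fst snd].
      replace (d' (word x i) (T' x (S i))) with (T' x i) by apply H'.
      replace (d (word x i) (T x (S i))) with (T x i) by apply H.
      apply Bool.eq_true_iff_eq.
      rewrite <- HU, Bool.orb_true_iff, Bool.andb_true_iff, <- HU, <- E, <- E'.
      split.
      * intros (j & Hj & Hb & Ha). destruct (Nat.eq_dec j i) as [->|]; auto.
        right. split; [apply Ha; lia|]. exists j. split; [lia|split; auto].
        intros k H1 H2. apply Ha; lia.
      * intros [Hb|[Ha (j & Hj & Hb & Hk)]].
        -- exists i. split; [lia|split; auto]. intros k H1 H2. lia.
        -- exists j. split; [lia|split; auto]. intros k H1 H2.
           destruct (Nat.eq_dec k i) as [->|]; auto. apply Hk; lia.
    + intros i [|].
      * eapply sigma3_equiv; [intros x; apply HU|auto].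
      * apply (@sigma3_equiv (fun x => ~ until x i)); auto.
        intros x. rewrite HU. destruct (U x i); intuition congruence.
    + intros x i. apply HU.
Qed.
End Words.

(** * Quantifier prefixes as games *)

Section Hyper.
Variable AP : Type.
Implicit Types (X : HSet AP) (D : AP -> Prop).

Lemma isHAsg_ap X D : isHAsg X D -> ap X = D.
Proof.
  intros ((Y & HY) & Hn & HD). apply functional_extensionality. intros q.
  apply propositional_extensionality. split.
  - intros (Z & HZ & chi & Hc & Hq). now apply (HD Z HZ chi Hc).
  - intros Hq. destruct (Hn Y HY) as [chi Hc].
    exists Y. split; auto. exists chi. split; auto. now apply (HD Y HY chi Hc).
Qed.

Lemma isHAsg_dual X D : isHAsg X D -> isHAsg (dual X) D.
Proof.
  intros ((Y & HY) & Hn & HD). split; [|split].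
  - set (c Z := epsilon (inhabits (fun _ : AP => @None tval)) Z).
    exists (fun chi => exists Z, X Z /\ chi = c Z), c. split; auto.
    intros Z HZ. apply epsilon_spec, Hn, HZ.
  - intros Z (c & Hc & ->). exists (c Y), Y. split; auto.
  - intros Z (c & Hc & ->) chi (Z' & HZ' & ->). apply (HD Z'), Hc; auto.
Qed.

Lemma isHAsg_ext X D sigma p : isHAsg X D ->
  isHAsg (ext_sigma sigma X p) (fun q => D q \/ q = p).
Proof.
  intros ((Y & HY) & Hn & HD). split; [|split].
  - exists (ext_set Y (fun _ _ => true) p), Y, (fun _ _ => true).
    split; auto. split; auto. split; intros q _ _ k chi1 chi2 _ _ _; auto.
  - intros Z (Y0 & F & H0 & _ & ->). destruct (Hn Y0 H0) as [chi Hc].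
    exists (upd chi p (F chi)), chi. auto.
  - intros Z (Y0 & F & H0 & _ & ->) chi (chi0 & Hc & ->) q.
    unfold upd. destruct excluded_middle_informative as [->|N].
    + split; [discriminate|auto].
    + rewrite <- (HD Y0 H0 chi0 Hc q). tauto.
Qed.

Definition dual_prefix (pfx : list (quant * AP * spec AP)) : list (quant * AP * spec AP) :=
  map (fun x => match x with (Q, p, s) => (dual_quant Q, p, s) end) pfx.

(** A quantifier and its dual under the flipped flag evaluate the body on the same hyperassignment,
    so only the LTL case has content. *)
Lemma sat_dual_prefix pfx (psi : ltl AP) : forall alpha X,
  sat (prefix_form (dual_prefix pfx) (LNot psi)) (flip alpha) X <->
  ~ sat (prefix_form pfx psi) alpha X.
Proof.
  induction pfx as [|[[Q p] s] pfx IH]; intros alpha X.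
  - unfold ltl_models in *. destruct alpha; simpl; unfold ltl_models; simpl.
    + split.
      * intros H (Y & HY & K). destruct (H Y HY) as (chi & Hc & N). now apply N, K.
      * intros N Y HY. apply NNPP; intros M. apply N. exists Y. split; auto.
        intros chi Hc. apply NNPP; intros K. eauto.
    + split.
      * intros (Y & HY & K) H. destruct (H Y HY) as (chi & Hc & N). now apply (K chi).
      * intros N. apply NNPP; intros M. apply N. intros Y HY.
        apply NNPP; intros K. apply M. exists Y. split; auto. eauto.
  - destruct Q, alpha; simpl; first [apply (IH EA)|apply (IH AE)].
Qed.

Lemma free_prefix pfx (psi : ltl AP) q :
  free (prefix_form pfx psi) q <->
  ltl_free psi q /\ ~ In q (map (fun x => snd (fst x)) pfx).
Proof.
  induction pfx as [|[[Q p] s] pfx IH]; simpl; [tauto|].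
  destruct Q; simpl; rewrite IH; intuition congruence.
Qed.

(** Each behavioral condition concerns one proposition, so [chi1] is turned into [chi2] one
    proposition at a time along the finite list [ps]. *)
Lemma functor_eq sigma D (F : Fnc AP) (ps : list AP) t chi1 chi2 :
  Fnc_sigma sigma D F -> (forall q, fst sigma q) -> (forall q, D q -> In q ps) ->
  Asg_on D chi1 -> Asg_on D chi2 ->
  (forall q f g, D q -> chi1 q = Some f -> chi2 q = Some g ->
     forall t', t' < t \/ (t' = t /\ ~ snd sigma q) -> f t' = g t') ->
  F chi1 t = F chi2 t.
Proof.
  intros [FB FS] HB Hps H1 H2 E.
  set (mix l := fun q => if excluded_middle_informative (In q l) then chi2 q else chi1 q).
  assert (Hm : forall l, Asg_on D (mix l)).
  { intros l q. unfold mix. destruct excluded_middle_informative; auto. }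
  assert (M : forall l, F (mix l) t = F chi1 t).
  { induction l as [|p l IH].
    - f_equal. apply functional_extensionality. intros q. unfold mix.
      destruct excluded_middle_informative as [[]|]; auto.
    - rewrite <- IH. destruct (classic (D p)) as [Dp|Np].
      + assert (Off : forall q, D q -> q <> p -> mix (p :: l) q = mix l q).
        { intros q _ Hq. unfold mix. simpl.
          destruct excluded_middle_informative, excluded_middle_informative; intuition congruence. }
        assert (On : forall f g, mix (p :: l) p = Some f -> mix l p = Some g ->
           forall t', t' < t \/ (t' = t /\ ~ snd sigma p) -> f t' = g t').
        { intros f g. unfold mix. simpl.
          destruct excluded_middle_informative as [_|N]; [|exfalso; auto].
          destruct excluded_middle_informative as [_|N].
          - intros -> Hg t' _. congruence.
          - intros Hf Hg t' Ht'. symmetry. now apply (E p g f). }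
        destruct (classic (snd sigma p)) as [Sp|Np].
        * apply (FS p); auto. split; [exact Off|]. intros f g Hf Hg t' Ht'. apply (On f g); auto.
        * apply (FB p); auto. split; [exact Off|]. intros f g Hf Hg t' Ht'. apply (On f g); auto.
          simpl in Ht'. destruct (Nat.eq_dec t' t); [auto|left; lia].
      + f_equal. apply functional_extensionality. intros q.
        unfold mix. simpl.
        destruct excluded_middle_informative as [[<-|i]|n],
          excluded_middle_informative as [i'|n']; auto; try tauto.
        specialize (H1 p). specialize (H2 p).
        destruct (chi1 p), (chi2 p); auto; exfalso; apply Np;
          first [apply H1; discriminate|apply H2; discriminate]. }
  rewrite <- (M ps). f_equal. apply functional_extensionality. intros q.
  unfold mix. destruct excluded_middle_informative as [|N]; auto.
  specialize (H1 q). specialize (H2 q).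
  destruct (chi1 q), (chi2 q); auto; exfalso; apply N, Hps;
    first [apply H1; discriminate|apply H2; discriminate].
Qed.
End Hyper.

(* Round [t] of the game fixes the values at time [t] of the propositions of [ps], in order:
   move [t * length ps + i] is the value at time [t] of the [i]-th proposition. *)
Section Game.
Variables (AP : Type) (ps : list AP) (default : AP).
Hypotheses (ps_nodup : NoDup ps) (ps_nonempty : 0 < length ps).

Let n := length ps.

Definition index (p : AP) : nat := epsilon (inhabits 0) (fun j => nth_error ps j = Some p).

Definition prop_at (m : nat) : AP := nth (m mod n) ps default.

Definition slot (t : nat) (p : AP) : nat := t * n + index p.

Definition round_word (x : nat -> bool) (t : nat) (q : AP) : bool :=
  if excluded_middle_informative (In q ps) then x (slot t q) else false.

Lemma index_spec p : In p ps -> nth_error ps (index p) = Some p.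
Proof.
  intros H. apply In_nth_error in H.
  exact (epsilon_spec (inhabits 0) (fun j => nth_error ps j = Some p) H).
Qed.

Lemma index_lt p : In p ps -> index p < n.
Proof.
  intros H. apply nth_error_Some. rewrite index_spec; auto. discriminate.
Qed.

Lemma index_nth j p : nth_error ps j = Some p -> index p = j.
Proof.
  intros H. assert (Hp : In p ps) by (eapply nth_error_In; eauto).
  eapply NoDup_nth_error; eauto.
  - now apply index_lt.
  - now rewrite index_spec, H.
Qed.

Lemma slot_mod t p : In p ps -> slot t p mod n = index p.
Proof.
  intros H. apply index_lt in H. unfold slot.
  rewrite Nat.add_comm, Nat.Div0.mod_add. now apply Nat.mod_small.
Qed.

Lemma slot_div t p : In p ps -> slot t p / n = t.
Proof.
  intros H. apply index_lt in H. unfold slot.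
  rewrite Nat.add_comm, Nat.div_add, Nat.div_small; lia.
Qed.

Lemma prop_at_slot t p : In p ps -> prop_at (slot t p) = p.
Proof.
  intros H. unfold prop_at. rewrite slot_mod by auto.
  apply nth_error_nth. now apply index_spec.
Qed.

Lemma slot_prop_at m : slot (m / n) (prop_at m) = m.
Proof.
  unfold slot. rewrite (@index_nth (m mod n)).
  - rewrite (Nat.div_mod m n) at 3; [lia|unfold n; lia].
  - apply nth_error_nth'. apply Nat.mod_upper_bound. unfold n. lia.
Qed.

Lemma round_word_prefix t : exists k, forall x y, pref x k = pref y k ->
  round_word x t = round_word y t.
Proof.
  exists (S t * n). intros x y E. apply functional_extensionality. intros q.
  unfold round_word. destruct excluded_middle_informative as [Hq|]; auto.
  eapply pref_eq_lt; eauto. apply index_lt in Hq. unfold slot. nia.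
Qed.

(** * Skolem functors from a winning strategy *)

Section Eloise.
(* [own p = true]: [p] is existentially quantified, hence chosen by Eloise. *)
Variables (own : AP -> bool) (psi : ltl AP) (s : list bool -> bool).
Hypothesis s_wins : forall x, follows (fun m => own (prop_at m)) true s 0 x ->
  ltl_sat (round_word x) psi 0.

Definition lookup (chi : Asg AP) (p : AP) (t : nat) : option bool :=
  match chi p with Some f => Some (f t) | None => None end.

(* The propositions already quantified by Abelard are read off [chi]; on the others he plays
   [a]. *)
Definition choose (chi : Asg AP) (a : list bool -> bool) (u : list bool) : bool :=
  if own (prop_at (length u)) then s u
  else match lookup chi (prop_at (length u)) (length u / n) with
       | Some b => b | None => a u end.

Fixpoint build chi a k : list bool :=
  match k with 0 => [] | S k => choose chi a (build chi a k) :: build chi a k end.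

Definition play chi a m : bool := choose chi a (build chi a m).

Lemma pref_play chi a k : pref (play chi a) k = build chi a k.
Proof. induction k as [|k IH]; simpl; [|rewrite IH]; reflexivity. Qed.

Lemma play_eq chi a m : play chi a m = choose chi a (pref (play chi a) m).
Proof. now rewrite pref_play. Qed.

Lemma play_follows chi a : follows (fun m => own (prop_at m)) true s 0 (play chi a).
Proof.
  intros m _ Ho. rewrite play_eq at 1. unfold choose. now rewrite pref_length, Ho.
Qed.

Lemma play_pref_eq chi1 a1 chi2 a2 k :
  (forall j, j < k -> pref (play chi1 a1) j = pref (play chi2 a2) j ->
     own (prop_at j) = false ->
     choose chi1 a1 (pref (play chi1 a1) j) = choose chi2 a2 (pref (play chi1 a1) j)) ->
  pref (play chi1 a1) k = pref (play chi2 a2) k.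
Proof.
  induction k as [|k IH]; intros H; auto. simpl.
  assert (E : pref (play chi1 a1) k = pref (play chi2 a2) k) by (apply IH; intros; apply H; auto).
  f_equal; auto. rewrite !play_eq, <- E.
  destruct (own (prop_at k)) eqn:Ho; [|apply H; auto].
  unfold choose. now rewrite pref_length, Ho.
Qed.

Lemma play_ext chi1 chi2 a m :
  (forall j, j <= m -> own (prop_at j) = false ->
     lookup chi1 (prop_at j) (j / n) = lookup chi2 (prop_at j) (j / n)) ->
  play chi1 a m = play chi2 a m.
Proof.
  intros H. apply (@pref_eq_lt _ _ (S m)); auto. apply play_pref_eq.
  intros j Hj _ Ho. unfold choose. rewrite pref_length, Ho, H; auto. lia.
Qed.

(** Only Eloise's propositions are compared with the play: Abelard's agree with it because [choose]
    copies them. *)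
Definition consistent (a : list bool -> bool) (chi : Asg AP) : Prop :=
  forall p f, own p = true -> chi p = Some f -> forall t, f t = play chi a (slot t p).

Definition inv (alpha : flag) (D : AP -> Prop) (X : HSet AP) : Prop :=
  isHAsg X D /\ (forall q, D q -> In q ps) /\
  forall a, match alpha with
    | EA => exists Y, X Y /\ forall chi, Y chi -> consistent a chi
    | AE => forall Y, X Y -> exists chi, Y chi /\ consistent a chi
    end.

(** A choice function picks from the good set of [EA]; conversely, choosing a consistent element in
    every set gives a good set. The latter depends on [a], as the invariant permits. *)
Lemma inv_dual alpha D X : inv alpha D X -> inv (flip alpha) D (dual X).
Proof.
  intros (H & Hps & HI). split; [now apply isHAsg_dual|split; auto].
  intros a. specialize (HI a). destruct alpha; simpl.
  - destruct HI as (Z & HZ & K). intros Y (c & Hc & ->).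
    exists (c Z). split; [exists Z; auto|apply K, Hc, HZ].
  - set (c Z := epsilon (inhabits (fun _ : AP => @None tval))
       (fun chi => Z chi /\ consistent a chi)).
    assert (Hc : forall Z, X Z -> Z (c Z) /\ consistent a (c Z)).
    { intros Z HZ. apply (epsilon_spec (inhabits (fun _ : AP => @None tval))
        (fun chi => Z chi /\ consistent a chi)), HI, HZ. }
    exists (fun chi => exists Z, X Z /\ chi = c Z). split.
    + exists c. split; auto. intros Z HZ. apply Hc, HZ.
    + intros chi (Z & HZ & ->). apply Hc, HZ.
Qed.

(* [p] is quantified with [sigma] when the propositions of [D] already are. In both clauses
   the restriction is that of the order of moves in a round. *)
Definition compatible (D : AP -> Prop) (p : AP) (sigma : spec AP) : Prop :=
  In p ps /\ ~ D p /\ (forall q, fst sigma q) /\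
  (forall q, D q -> (snd sigma q -> index p < index q) /\
                    (index p < index q -> snd sigma q)).

Lemma lookup_upd_other chi p f q t : q <> p -> lookup (upd chi p f) q t = lookup chi q t.
Proof.
  intros H. unfold lookup, upd. destruct excluded_middle_informative; [contradiction|auto].
Qed.

Lemma upd_same chi (p : AP) f : upd chi p f p = Some f.
Proof. unfold upd. destruct excluded_middle_informative; congruence. Qed.

Lemma upd_other chi (p : AP) f q : q <> p -> upd chi p f q = chi q.
Proof. unfold upd. destruct excluded_middle_informative; congruence. Qed.

(** The Skolem functor reads [p] off the play against [a]. Recording [p] in the assignment leaves
    the play unchanged, since moves of Eloise are never looked up. *)
Lemma inv_exists D X p sigma : compatible D p sigma -> own p = true ->
  inv EA D X -> inv EA (fun q => D q \/ q = p) (ext_sigma sigma X p).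
Proof.
  intros (Hp & ND & _ & HS) Ho (HX & Hps & HI).
  split; [now apply isHAsg_ext|split].
  { intros q [?| ->]; auto. }
  intros a. destruct (HI a) as (Y & HY & K).
  set (F chi t := play chi a (slot t p)).
  assert (HF : forall strong q, D q -> (strong = true -> snd sigma q) ->
     behavioral_wrt D strong F q).
  { intros strong q Dq Hst k chi1 chi2 H1 H2 [E1 E2]. apply play_ext.
    intros j Hj _. unfold lookup.
    destruct (classic (prop_at j = q)) as [Eq|Nq].
    - rewrite Eq. pose proof (proj1 (H1 q) Dq) as S1. pose proof (proj1 (H2 q) Dq) as S2.
      destruct (chi1 q) as [f1|], (chi2 q) as [f2|]; try congruence.
      f_equal. apply E2; auto.
      (* A slot of [q] up to that of [p] in round [k] lies in a round at most [k], and strictly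
         before [k] if [p] moves before [q]. *)
      assert (Hjn : slot (j / n) q = j) by (rewrite <- Eq; apply slot_prop_at).
      assert (Hle : slot (j / n) q <= slot k p) by lia.
      pose proof (index_lt _ Hp). pose proof (index_lt _ (Hps q Dq)).
      unfold slot in Hle. destruct strong.
      + destruct (HS q Dq) as [HS1 _]. specialize (HS1 (Hst eq_refl)). nia.
      + nia.
    - destruct (classic (D (prop_at j))) as [Dj|Nj].
      + now rewrite E1.
      + specialize (H1 (prop_at j)). specialize (H2 (prop_at j)).
        destruct (chi1 (prop_at j)) as [f1|].
        { exfalso. apply Nj, H1. discriminate. }
        destruct (chi2 (prop_at j)) as [f2|]; auto.
        exfalso. apply Nj, H2. discriminate. }
  exists (ext_set Y F p). split.
  - exists Y, F. split; auto. split; auto. rewrite (isHAsg_ap HX).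
    split; intros q Hq Dq; apply HF; auto. discriminate.
  - intros chi' (chi & Hc & ->).
    assert (E : forall m, play (upd chi p (F chi)) a m = play chi a m).
    { intros m. apply play_ext. intros j _ Hj. apply lookup_upd_other. congruence. }
    intros q f Hq. destruct (classic (q = p)) as [->|N].
    + rewrite upd_same. intros [= <-] t. now rewrite E.
    + rewrite upd_other by auto. intros Hf t. rewrite E. now apply (K chi).
Qed.

(** Counted from the end because the latest move is at the head; meaningful only for moves already
    made. *)
Definition bit (u : list bool) (m : nat) : bool := nth (length u - S m) u false.

Lemma bit_pref x k m : m < k -> bit (pref x k) m = x m.
Proof.
  unfold bit. rewrite pref_length. induction k as [|k IH]; intros H; [lia|].
  simpl. destruct (Nat.eq_dec m k) as [->|].
  - now rewrite Nat.sub_diag.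
  - specialize (IH ltac:(lia)). replace (k - m) with (S (k - S m)) by lia. exact IH.
Qed.

(** Abelard's functor [F] becomes part of his continuation: [a'] plays [p] by applying [F] to the
    position and otherwise follows [a]. Adding [F chi] to an assignment consistent with [a'] gives
    the same play against [a]. *)
Lemma inv_forall D X p sigma : compatible D p sigma -> own p = false ->
  inv AE D X -> inv AE (fun q => D q \/ q = p) (ext_sigma sigma X p).
Proof.
  intros (Hp & ND & HB & HS) Ho (HX & Hps & HI).
  split; [now apply isHAsg_ext|split].
  { intros q [?| ->]; auto. }
  intros a Y (Y0 & F & HY0 & HF & ->). rewrite (isHAsg_ap HX) in HF.
  (* Values at moves not yet made are arbitrary here; [F] cannot read them. *)
  set (asg (u : list bool) := fun q => if excluded_middle_informative (D q)
     then Some (fun t => bit u (slot t q)) else None).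
  set (a' u := if excluded_middle_informative (prop_at (length u) = p)
     then F (asg u) (length u / n) else a u).
  destruct (HI a' Y0 HY0) as (chi & Hc & K).
  assert (Hon : Asg_on D chi) by (apply (proj2 (proj2 HX) Y0); auto).
  assert (Np : chi p = None).
  { specialize (Hon p). destruct (chi p); auto. exfalso. apply ND, Hon. discriminate. }
  exists (upd chi p (F chi)). split; [exists chi; auto|].
  assert (E : forall k, pref (play chi a') k = pref (play (upd chi p (F chi)) a) k).
  { intros k. apply play_pref_eq. intros j Hj _ Hown.
    unfold choose. rewrite pref_length, Hown.
    destruct (classic (prop_at j = p)) as [Ej|Nj].
    - rewrite Ej. unfold lookup. rewrite upd_same, Np. unfold a'.
      rewrite pref_length. destruct excluded_middle_informative; [|contradiction].
      symmetry. eapply functor_eq; eauto.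
      + intros q. unfold asg. destruct excluded_middle_informative; intuition congruence.
      + intros q f g Dq Hf Hg t' Ht'. unfold asg in Hg.
        destruct excluded_middle_informative; [|contradiction].
        injection Hg; intros <-.
        (* Everything [F] may read precedes move [j]: in the same round, compatibility rules out
           larger indices, and [~ D p] rules out [p] itself. *)
        assert (Hlt : slot t' q < j).
        { rewrite <- (slot_prop_at j), Ej. pose proof (index_lt _ Hp).
          pose proof (index_lt _ (Hps q Dq)). unfold slot.
          destruct Ht' as [Ht'|[-> Nq]]; [nia|].
          destruct (HS q Dq) as [_ HS2].
          destruct (lt_eq_lt_dec (index q) (index p)) as [[|Eq]|]; [lia| |tauto].
          exfalso. apply ND.
          assert (q = p) as <-; auto.
          pose proof (index_spec _ (Hps q Dq)) as I1. pose proof (index_spec _ Hp) as I2.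
          congruence. }
        rewrite bit_pref by auto.
        destruct (own q) eqn:Hq.
        * now apply (K q).
        * rewrite play_eq. unfold choose, lookup.
          rewrite pref_length, prop_at_slot, Hq, Hf, slot_div by auto. auto.
    - rewrite lookup_upd_other by auto.
      destruct lookup; auto. unfold a'. rewrite pref_length.
      destruct excluded_middle_informative; [contradiction|auto]. }
  intros q f Hq. rewrite upd_other by congruence. intros Hf t.
  rewrite (K q f Hq Hf t). eapply pref_eq_lt; [apply (E (S (slot t q)))|lia].
Qed.

Lemma inv_ltl alpha X : inv alpha (fun q => In q ps) X -> sat (FLTL psi) alpha X.
Proof.
  (* With all propositions quantified the continuation is never consulted, so any will do. *)
  intros ((_ & _ & HX) & _ & HI). specialize (HI (fun _ => true)).
  assert (M : forall Y chi, X Y -> Y chi -> consistent (fun _ => true) chi -> ltl_models chi psi).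
  { intros Y chi HY Hc K. unfold ltl_models.
    replace (word_of chi) with (round_word (play chi (fun _ => true))).
    - apply s_wins, play_follows.
    - apply functional_extensionality. intros t. apply functional_extensionality. intros q.
      unfold round_word, word_of. specialize (HX Y HY chi Hc q).
      destruct excluded_middle_informative as [Hq|Nq].
      + destruct (chi q) as [f|] eqn:Hf; [|tauto].
        destruct (own q) eqn:Ho.
        * symmetry. now apply K.
        * rewrite play_eq. unfold choose, lookup.
          now rewrite pref_length, prop_at_slot, Ho, Hf, slot_div by auto.
      + destruct (chi q); auto. exfalso. apply Nq, HX. discriminate. }
  destruct alpha; simpl.
  - destruct HI as (Y & HY & K). eauto.
  - intros Y HY. destruct (HI Y HY) as (chi & Hc & K). eauto.
Qed.

Fixpoint compatible_prefix (D : AP -> Prop) (pfx : list (quant * AP * spec AP)) : Prop :=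
  match pfx with
  | [] => D = (fun q => In q ps)
  | (Q, p, sigma) :: pfx =>
      compatible D p sigma /\ own p = match Q with QEx => true | QAll => false end /\
      compatible_prefix (fun q => D q \/ q = p) pfx
  end.

Lemma inv_sat pfx : forall D alpha X, compatible_prefix D pfx -> inv alpha D X ->
  sat (prefix_form pfx psi) alpha X.
Proof.
  induction pfx as [|[[Q p] sigma] pfx IH]; intros D alpha X.
  - simpl compatible_prefix. intros ->. apply inv_ltl.
  - intros (HC & Ho & HP) HI. destruct Q, alpha; simpl; eapply IH; eauto.
    + now apply inv_exists.
    + apply inv_exists; auto. apply (inv_dual HI).
    + apply inv_forall; auto. apply (inv_dual HI).
    + now apply inv_forall.
Qed.

Lemma inv_start alpha D X : isHAsg X D -> (forall q, ~ D q) -> inv alpha D X.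
Proof.
  intros HX N. split; auto. split; [intros q Hq; now destruct (N q)|].
  destruct HX as ((Y & HY) & Hn & HD). intros a.
  assert (K : forall Z chi, X Z -> Z chi -> consistent a chi).
  { intros Z chi HZ Hc p f _ Hf. exfalso. apply (N p), (HD Z HZ chi Hc p). congruence. }
  destruct alpha.
  - exists Y. eauto.
  - intros Z HZ. destruct (Hn Z HZ) as [chi Hc]. eauto.
Qed.
End Eloise.

Lemma compatible_dual own pfx : forall D, compatible_prefix own D pfx ->
  compatible_prefix (fun p => negb (own p)) D (dual_prefix pfx).
Proof.
  induction pfx as [|[[Q p] sigma] pfx IH]; intros D; simpl; auto.
  intros (HC & Ho & HP). split; auto. split; auto. rewrite Ho. destruct Q; auto.
Qed.

Definition eloise_wins own psi := exists s, forall x,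
  follows (fun m => own (prop_at m)) true s 0 x -> ltl_sat (round_word x) psi 0.

(** The game depends on the owners and the order of [ps] only, so it serves every compatible prefix.
    Determinacy gives the forward direction: a win of Abelard would make the dual sentence true. *)
Lemma satisfiable_iff_wins own pfx psi :
  compatible_prefix own (fun _ => False) pfx -> sentence (prefix_form pfx psi) ->
  satisfiable (prefix_form pfx psi) <-> eloise_wins own psi.
Proof.
  intros HC Hs.
  assert (HF : free (prefix_form pfx psi) = fun _ => False).
  { apply functional_extensionality. intros q. apply propositional_extensionality.
    split; [apply Hs|tauto]. }
  unfold satisfiable, alpha_satisfiable. rewrite HF. split.
  - intros [(X & HX & Hsat) _].
    destruct (@sigma3_determined (fun m => own (prop_at m))
       (fun x => ltl_sat (round_word x) psi 0)) as [W|[s W]]; auto.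
    + apply (@recognized_sigma3 _ round_word (fun x i => ltl_sat (round_word x) psi i)).
      apply ltl_recognized, round_word_prefix.
    + exfalso. revert Hsat. apply sat_dual_prefix.
      (* Abelard's strategy is a winning one for Eloise once owners are swapped and [psi] is
         negated. *)
      eapply (@inv_sat (fun p => negb (own p)) (LNot psi) s).
      * intros x Hx. apply W. intros m Hm Ho. apply Hx; auto. now rewrite Ho.
      * apply compatible_dual, HC.
      * apply (inv_start _ _ _ HX); auto.
  - intros [s W].
    assert (isHAsg (fun Y => Y = fun chi : Asg AP => chi = fun _ => None) (fun _ => False)) as HX.
    { split; [|split].
      - eexists; reflexivity.
      - intros Y ->. eexists; reflexivity.
      - intros Y -> chi -> q. split; [tauto|congruence]. }
    split; eexists; (split; [exact HX|]); eapply inv_sat; eauto; apply (inv_start _ _ _ HX); auto.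
Qed.
End Game.

(** * Canonical prefixes share the game of the original prefix *)

Section Canonical.
Variables (AP : Type) (pre : list (quant * AP)).
Hypothesis pre_nodup : NoDup (map snd pre).

Let ps := map snd pre.

Definition existential (p : AP) : bool :=
  if excluded_middle_informative (In (QEx, p) pre) then true else false.

Lemma existential_spec Q p : In (Q, p) pre ->
  existential p = match Q with QEx => true | QAll => false end.
Proof.
  intros H. unfold existential. destruct excluded_middle_informative as [H'|N].
  - destruct Q; auto. exfalso. clear ps. induction pre as [|[Q p'] l IH]; auto.
    simpl in *. inversion pre_nodup as [|? ? N ND]; subst.
    destruct H as [H|H], H' as [H'|H']; auto; try congruence;
      apply N, in_map_iff.
    + exists (QEx, p). split; auto; simpl; congruence.
    + exists (QAll, p). split; auto; simpl; congruence.
  - destruct Q; [contradiction|auto].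
Qed.

Lemma index_split l0 p l : ps = l0 ++ p :: l -> index ps p = length l0.
Proof.
  intros E. apply index_nth; auto. rewrite E.
  rewrite nth_error_app2, Nat.sub_diag by auto. reflexivity.
Qed.

Lemma index_before l0 p l q : ps = l0 ++ p :: l -> In q l0 -> index ps q < index ps p.
Proof.
  intros E Hq. rewrite (index_split _ _ _ E).
  apply in_split in Hq. destruct Hq as (l1 & l2 & ->).
  rewrite <- app_assoc in E. simpl in E. rewrite (index_split _ _ _ E), length_app. simpl. lia.
Qed.

Lemma index_after l0 p l q : ps = l0 ++ p :: l -> In q l -> index ps p < index ps q.
Proof.
  intros E Hq. apply in_split in Hq. destruct Hq as (l1 & l2 & ->).
  eapply (@index_before (l0 ++ p :: l1) q l2); [|apply in_or_app; simpl; auto].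
  rewrite <- app_assoc. simpl. exact E.
Qed.

Lemma pred_ext (D D' : AP -> Prop) : (forall q, D q <-> D' q) -> D = D'.
Proof.
  intros H. apply functional_extensionality. intros q. now apply propositional_extensionality.
Qed.

(** In the original order everything already quantified moves earlier in the round, so no strong
    dependence is called for. *)
Lemma behav_compatible l0 l : pre = l0 ++ l ->
  compatible_prefix ps existential (fun q => In q (map snd l0)) (behav l).
Proof.
  revert l0. induction l as [|[Q p] l IH]; intros l0 E.
  - simpl. unfold ps. now rewrite E, app_nil_r.
  - assert (Eps : ps = map snd l0 ++ p :: map snd l).
    { unfold ps. rewrite E, map_app. reflexivity. }
    simpl. split; [split; [|split; [|split]]|split].
    + rewrite Eps. apply in_or_app. simpl. auto.
    + intros H. pose proof (@index_before _ _ _ _ Eps H). lia.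
    + simpl. auto.
    + intros q Hq. pose proof (@index_before _ _ _ _ Eps Hq). simpl. split; [tauto|lia].
    + apply existential_spec. rewrite E. apply in_or_app. simpl. auto.
    + replace (fun q => In q (map snd l0) \/ q = p)
        with (fun q => In q (map snd (l0 ++ [(Q, p)]))).
      * apply IH. rewrite <- app_assoc. exact E.
      * apply pred_ext. intros q. rewrite map_app, in_app_iff. simpl. intuition congruence.
Qed.

Lemma props_of_spec Q (l : list (quant * AP)) q : In q (props_of Q l) <-> In (Q, q) l.
Proof.
  unfold props_of. rewrite in_map_iff. split.
  - intros ([Q' q'] & <- & H). apply filter_In in H. simpl in *.
    destruct Q, Q', H; auto; discriminate.
  - intros H. exists (Q, q). split; auto. apply filter_In. split; auto. now destruct Q.
Qed.

(** The already quantified propositions that move after [p] are exactly the [Q]-quantified ones of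
    the remaining prefix, which is the strong part of the specification. *)
Lemma tail_compatible Q l0 l : pre = l0 ++ l ->
  compatible_prefix ps existential
    (fun q => In (Q, q) pre \/ In q (map snd l0)) (tail_part Q l).
Proof.
  revert l0. induction l as [|[Q' p] l IH]; intros l0 E.
  - simpl. apply pred_ext. intros q. rewrite app_nil_r in E. subst l0. split; auto.
    intros [H|H]; auto. change q with (snd (Q, q)). now apply in_map.
  - assert (Eps : ps = map snd l0 ++ p :: map snd l).
    { unfold ps. rewrite E, map_app. reflexivity. }
    assert (Hin : In (Q', p) pre) by (rewrite E; apply in_or_app; simpl; auto).
    assert (IH' : compatible_prefix ps existential
      (fun q => In (Q, q) pre \/ In q (map snd (l0 ++ [(Q', p)]))) (tail_part Q l)).
    { apply IH. rewrite <- app_assoc. exact E. }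
    assert (Hafter : forall q, In q (props_of Q l) -> index ps p < index ps q).
    { intros q Hq. apply props_of_spec in Hq. eapply index_after; eauto.
      change q with (snd (Q, q)). now apply in_map. }
    simpl. destruct (match Q' with QEx => _ | QAll => _ end) eqn:EQ.
    + assert (Q' = Q) as -> by (destruct Q, Q'; first [reflexivity|congruence]).
      replace (fun q => In (Q, q) pre \/ In q (map snd l0))
        with (fun q => In (Q, q) pre \/ In q (map snd (l0 ++ [(Q, p)]))); auto.
      apply pred_ext. intros q. rewrite map_app, in_app_iff. simpl.
      split; [intros [|[|[<-|[]]]]|]; tauto.
    + assert (NQ : Q' <> Q) by (intros ->; destruct Q; discriminate).
      split; [split; [|split; [|split]]|split].
      * rewrite Eps. apply in_or_app. simpl. auto.
      * intros [H|H].
        -- apply existential_spec in H. apply existential_spec in Hin.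
           destruct Q, Q'; congruence.
        -- pose proof (@index_before _ _ _ _ Eps H). lia.
      * simpl. auto.
      * intros q Hq. simpl. split; [intros [[]|H]; auto|]. intros Hlt. right.
        destruct Hq as [Hq|Hq].
        -- apply props_of_spec. rewrite E in Hq. apply in_app_or in Hq.
           destruct Hq as [Hq|[Hq|Hq]]; auto; [|congruence].
           apply (in_map snd) in Hq. pose proof (@index_before _ _ _ _ Eps Hq). simpl in *. lia.
        -- pose proof (@index_before _ _ _ _ Eps Hq). lia.
      * now apply existential_spec.
      * replace (fun q => (In (Q, q) pre \/ In q (map snd l0)) \/ q = p)
          with (fun q => In (Q, q) pre \/ In q (map snd (l0 ++ [(Q', p)]))); auto.
        apply pred_ext. intros q. rewrite map_app, in_app_iff. simpl. intuition congruence.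
Qed.

Lemma head_compatible Q rest l0 l : pre = l0 ++ l ->
  compatible_prefix ps existential (fun q => In (Q, q) pre) rest ->
  compatible_prefix ps existential (fun q => In (Q, q) l0)
    (map (fun p => (Q, p, @specB AP)) (props_of Q l) ++ rest).
Proof.
  intros E HR. revert l0 E. induction l as [|[Q' p] l IH]; intros l0 E.
  - simpl. rewrite app_nil_r in E. now subst l0.
  - assert (Eps : ps = map snd l0 ++ p :: map snd l).
    { unfold ps. rewrite E, map_app. reflexivity. }
    assert (Hin : In (Q', p) pre) by (rewrite E; apply in_or_app; simpl; auto).
    assert (Hbefore : forall q, In (Q, q) l0 -> index ps q < index ps p).
    { intros q Hq. eapply index_before; eauto. change q with (snd (Q, q)). now apply in_map. }
    specialize (IH (l0 ++ [(Q', p)])). rewrite <- app_assoc in IH. specialize (IH E).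
    destruct (classic (Q' = Q)) as [->|NQ].
    + replace (props_of Q ((Q, p) :: l)) with (p :: props_of Q l) by now destruct Q.
      simpl. split; [split; [|split; [|split]]|split].
      * rewrite Eps. apply in_or_app. simpl. auto.
      * intros H. specialize (Hbefore p H). lia.
      * simpl. auto.
      * intros q Hq. specialize (Hbefore q Hq). simpl. split; [tauto|lia].
      * now apply existential_spec.
      * replace (fun q => In (Q, q) l0 \/ q = p)
          with (fun q => In (Q, q) (l0 ++ [(Q, p)])); auto.
        apply pred_ext. intros q. rewrite in_app_iff. simpl. intuition congruence.
    + replace (props_of Q ((Q', p) :: l)) with (props_of Q l)
        by (destruct Q, Q'; first [reflexivity|congruence]).
      replace (fun q => In (Q, q) l0) with (fun q => In (Q, q) (l0 ++ [(Q', p)])); auto.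
      apply pred_ext. intros q. rewrite in_app_iff. simpl. intuition congruence.
Qed.

Lemma canon_compatible Q : compatible_prefix ps existential (fun _ => False) (canon Q pre).
Proof.
  apply (@head_compatible Q _ []); auto.
  replace (fun q => In (Q, q) pre)
    with (fun q => In (Q, q) pre \/ In q (map snd (@nil (quant * AP)))).
  - now apply tail_compatible.
  - apply pred_ext. simpl. tauto.
Qed.

Lemma compatible_covers pfx : forall D, compatible_prefix ps existential D pfx ->
  forall q, In q ps -> D q \/ In q (map (fun x => snd (fst x)) pfx).
Proof.
  induction pfx as [|[[Q p] sigma] pfx IH]; intros D; simpl.
  - intros ->. auto.
  - intros (_ & _ & H) q Hq. destruct (IH _ H q Hq) as [[|]|]; auto.
Qed.

Lemma canonical_equisatisfiable Q (psi : ltl AP) : sentence (prefix_form (behav pre) psi) ->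
  satisfiable (prefix_form (behav pre) psi) <-> satisfiable (prefix_form (canon Q pre) psi).
Proof.
  (* The empty prefix is treated apart because a round of the game needs at least one move. *)
  intros Hs. destruct (Nat.eq_dec (length pre) 0) as [E|N].
  { apply length_zero_iff_nil in E. rewrite E. simpl. tauto. }
  assert (Hps : 0 < length ps) by (unfold ps; rewrite length_map; lia).
  assert (default : AP) by (destruct ps; [simpl in Hps; lia|auto]).
  assert (Hc : sentence (prefix_form (canon Q pre) psi)).
  { intros q Hq. apply free_prefix in Hq. destruct Hq as [Hq Nq].
    apply (Hs q), free_prefix. split; auto. intros Hin. apply Nq.
    destruct (@compatible_covers _ _ (canon_compatible Q) q) as [[]|]; auto.
    unfold behav in Hin. rewrite map_map in Hin. exact Hin. }
  rewrite (@satisfiable_iff_wins _ ps default pre_nodup Hps existential (behav pre)); auto.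
  - rewrite (@satisfiable_iff_wins _ ps default pre_nodup Hps existential (canon Q pre)); auto.
    + tauto.
    + apply canon_compatible.
  - exact (@behav_compatible [] pre eq_refl).
Qed.
End Canonical.

Theorem mainTheorem14 (AP : Type) (pre : list (quant * AP)) (psi : ltl AP) :
  NoDup (map snd pre) ->
  sentence (prefix_form (behav pre) psi) ->
  (satisfiable (prefix_form (behav pre) psi) <->
     satisfiable (prefix_form (C_EA pre) psi)) /\
  (satisfiable (prefix_form (behav pre) psi) <->
     satisfiable (prefix_form (C_AE pre) psi)).
Proof.
  intros ND Hs. split; now apply canonical_equisatisfiable.
Qed.
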